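(* Let $P$ be an increasing tableau, $(R,C)$ an outer cell of $P$, and $\alpha\in\{0,1\}$. Let $(P',m)$ be the output of reverse row insertion on $(P,(R,C),\alpha)$. If $\alpha=0$ then $K_-(P)=K_-(P')$. If $\alpha=1$ then $K_-(P)$ and $K_-(P')$ agree in every column except column $C$, where (as sets) $$K_-(P')_C=K_-(P)_C\setminus\{\min(K_-(P)_C\setminus K_-(P)_{C+1})\},$$ with $K_-(P)_{C+1}=\emptyset$ if $K_-(P)$ has no column $C+1$.
   Context: Tableaux are in English convention; $T(r,c)$ is the entry in row $r$, column $c$; $T_j$ is the set of entries in column $j$. An increasing tableau has positive integer entries strictly increasing along rows and columns. For finite $S,T\subseteq\mathbb{Z}_{>0}$, $T\triangleleft S$ is obtained by going through $S$ from largest to smallest, each $s$ picking the largest not-yet-picked element of $T$ less than $s$ (if any), and taking the picked set. The left key $K_-(P)$ of an increasing tableau $P$ is the tableau of the same shape whose column $j$ consists of $P_1\triangleleft(P_2\triangleleft(\cdots\triangleleft P_j))$ in increasing order. Reverse row insertion. $P_{r\downarrow}$ is $P$ with its first $r-1$ rows deleted. A value $x$ is ejectable in $P$ if $x$ is in the first row of $P$ and either $x+1$ is not in the first row, or $x+1$ is in the first row and is ejectable in $P_{2\downarrow}$. A cell $(r,c)$ is outer if neither $(r+1,c)$ nor $(r,c+1)$ is a cell. The bumping path of $(r,c)$ is $(r,c_r),\dots,(1,c_1)$ with $c_r=c$ and $c_i$ the largest index with $P(i,c_i)<P(i+1,c_{i+1})$; $m_i=P(i,c_i)$. Input: $P$,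 outer cell $(r,c)$, $\alpha\in\{0,1\}$; output $(P',m)$ with $m=m_1$. Start with $P'=P$. If $\alpha=1$, delete cell $(r,c)$ from $P'$, $\alpha_r=1$, $i=r-1$; if $\alpha=0$, $m_{r+1}=\infty$, $\alpha_{r+1}=0$, $i=r$. While $i\ge1$, with $R$ the set of entries of row $i$ of $P$: (D) if $m_i+1\in R$, leave row $i$, $\alpha_i=\alpha_{i+1}$; (DR) else if $\alpha_{i+1}=1$ and $m_{i+1}\notin R$, replace $m_i$ by $m_{i+1}$ in row $i$ of $P'$, $\alpha_i=1$; otherwise let $x$ be the largest value ejectable in the current $P'_{(i+1)\downarrow}$ with $m_i<x<m_{i+1}$: (IR) if it exists replace $m_i$ by $x$ in row $i$ of $P'$, $\alpha_i=1$; (NR) otherwise leave row $i$, $\alpha_i=0$. Decrease $i$ by one; at $i=0$ output $P'$ (an increasing tableau). *)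

(* Defs.v *)
From mathcomp Require Import all_boot.
Set Implicit Arguments. Unset Strict Implicit. Unset Printing Implicit Defensive.

(* Conventions: a tableau is a list of rows (English convention, top row first).
   ROW AND COLUMN INDICES ARE 0-BASED: the paper's cell (r,c) is (r-1,c-1) here. *)
Definition tableau := seq (seq nat).

Definition trow (P : tableau) (i : nat) : seq nat := nth [::] P i.
Definition entry (P : tableau) (i j : nat) : nat := nth 0 (trow P i) j.
Definition is_cell (P : tableau) (i j : nat) : bool := j < size (trow P i).

Definition col (P : tableau) (j : nat) : seq nat :=
  [seq nth 0 rw j | rw <- P & j < size rw].

Definition is_shape (P : tableau) : bool :=
  all (fun rw => 0 < size rw) P && sorted geq (map size P).

Definition increasing_tableau (P : tableau) : Prop :=
  [/\ is_shape P,
      all (all (fun x => 0 < x)) P,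
      all (sorted ltn) P &
      forall i j, is_cell P i.+1 j -> entry P i j < entry P i.+1 j].

Definition tri_step (st : seq nat * seq nat) (s : nat) : seq nat * seq nat :=
  let: (avail, picked) := st in
  let cs := [seq x <- avail | x < s] in
  if cs is [::] then st
  else let x := \max_(y <- cs) y in (rem x avail, x :: picked).

Definition tri (T S : seq nat) : seq nat :=
  sort leq (foldl tri_step (T, [::]) (sort geq (undup S))).2.

Definition keycol (P : tableau) (j : nat) : seq nat :=
  foldr (fun i acc => tri (undup (col P i)) acc) (col P j) (iota 0 j).

Definition leftkey (P : tableau) : tableau :=
  [seq [seq nth 0 (keycol P j) i | j <- iota 0 (size (trow P i))]
     | i <- iota 0 (size P)].

Definition outer_cell (P : tableau) (r c : nat) : bool :=
  [&& is_cell P r c, ~~ is_cell P r.+1 c & ~~ is_cell P r c.+1].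

Fixpoint ejectable (P : tableau) (x : nat) : bool :=
  match P with
  | [::] => false
  | rw :: rest => (x \in rw) && ((x.+1 \notin rw) || ejectable rest x.+1)
  end.

(* bumping path of the cell (r,c): bump_col P r c d is the column c_{r-d}
   of the path in row r-d (for d <= r). *)
Fixpoint bump_col (P : tableau) (r c d : nat) : nat :=
  match d with
  | 0 => c
  | d'.+1 =>
      \max_(j < size (trow P (r - d'.+1))
             | entry P (r - d'.+1) j < entry P (r - d') (bump_col P r c d')) (val j)
  end.

Definition bump_val (P : tableau) (r c i : nat) : nat :=
  entry P i (bump_col P r c (r - i)).

Definition replace_in_row (P : tableau) (i v w : nat) : tableau :=
  set_nth [::] P i [seq (if y == v then w else y) | y <- trow P i].

Definition delete_cell (P : tableau) (r c : nat) : tableau :=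
  [seq rw <- set_nth [::] P r (take c (trow P r)) | rw != [::]].

Definition lt_opt (x : nat) (m : option nat) : bool :=
  if m is Some v then x < v else true.

(* processing row i (0-based): P0 = original tableau, P' = current tableau,
   a = alpha_{i+1}, mnext = m_{i+1} (None = infinity). Returns (P', alpha_i). *)
Definition rri_row (P0 : tableau) (r c i : nat) (P' : tableau) (a : bool)
    (mnext : option nat) : tableau * bool :=
  let mi := bump_val P0 r c i in
  let R := trow P0 i in
  if mi.+1 \in R then (P', a)
  else match (if a then mnext else None) with
  | Some v => if v \notin R then (replace_in_row P' i mi v, true) else
      let cs := [seq x <- trow P' i.+1 | [&& mi < x, lt_opt x mnext
                                            & ejectable (drop i.+1 P') x]] in
      if cs is [::] then (P', false)
      else (replace_in_row P' i mi (\max_(x <- cs) x), true)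
  | None =>
      let cs := [seq x <- trow P' i.+1 | [&& mi < x, lt_opt x mnext
                                            & ejectable (drop i.+1 P') x]] in
      if cs is [::] then (P', false)
      else (replace_in_row P' i mi (\max_(x <- cs) x), true)
  end.

Fixpoint rri_loop (P0 : tableau) (r c n : nat) (P' : tableau) (a : bool)
    (mnext : option nat) : tableau :=
  match n with
  | 0 => P'
  | n'.+1 =>
      let st := rri_row P0 r c n' P' a mnext in
      rri_loop P0 r c n' st.1 st.2 (Some (bump_val P0 r c n'))
  end.

Definition reverse_row_insertion (P : tableau) (r c : nat) (alpha : bool)
    : tableau * nat :=
  let P' := if alpha then rri_loop P r c r (delete_cell P r c) true
                              (Some (bump_val P r c r))
            else rri_loop P r c r.+1 P false None in
  (P', bump_val P r c 0).

(* Main.v *)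
Require Import Defs.
From mathcomp Require Import all_boot zify.

(** Scan the values downwards: an element of [S] is a customer arriving at a
   queue, an element of [T] a service event, and [T <| S] is the set of services
   that are used. The column [j] of the left key is then the output of a tandem
   of queues with services [P_1, .., P_(j-1)] fed with the arrivals [P_j].
   Reverse insertion replaces, row after row along the bumping path, a value [m]
   of a column by a larger value [g] occurring in the next row further left.
   Adding the service [g] to a column does not affect the output of the column
   on its left, which is busy below [g]; once the path leaves a column, the value
   [m] ejected from it is a service at which the queue is empty, because the
   rows of the tableau match every earlier arrival with an earlier service, so
   [m] can be dropped. If a cell is deleted, the value finally dropped from the
   column [C] is the least one not used by the arrivals from the column [C+1],
   and being the least unused value is preserved by every queue. *)

(** * Queues *)

(** Values are read from [N - 1] down to [v]. At each value the service precedes the arrival, so a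
    customer is served strictly below its own value, and truncated subtraction lets a service at an
    empty queue go to waste. *)
Definition queue (N : nat) (T S : pred nat) (v : nat) : nat :=
  foldr (fun x q => q - T x + S x) 0 (iota v (N - v)).

Definition serve (N : nat) (T S : pred nat) : pred nat :=
  fun v => T v && (0 < queue N T S v.+1).

Lemma queueS N T S v : v < N ->
  queue N T S v = queue N T S v.+1 - T v + S v.
Proof. by move=> lt_vN; rewrite /queue -[in LHS]subnSK. Qed.

Lemma queue_ge N T S v : N <= v -> queue N T S v = 0.
Proof. by rewrite -subn_eq0 /queue => /eqP->. Qed.

Lemma down_ind N (Q : nat -> Prop) :
  (forall v, N <= v -> Q v) -> (forall v, v < N -> Q v.+1 -> Q v) ->
  forall v, Q v.
Proof.
move=> Qge Qlt v; have [k] := ubnP (N - v); elim: k v => // k IHk v lt_k.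
by have [/Qge//|lt_vN] := leqP N v; apply: Qlt => //; apply: IHk; lia.
Qed.

Lemma eq_queue N T T' S S' : T =1 T' -> S =1 S' ->
  queue N T S =1 queue N T' S'.
Proof. by move=> eT eS v; rewrite /queue; elim: iota => //= x l ->; rewrite eT eS. Qed.

Lemma eq_serve N T T' S S' : T =1 T' -> S =1 S' ->
  serve N T S =1 serve N T' S'.
Proof. by move=> eT eS v; rewrite /serve eT (eq_queue _ _ _ _ _ eT eS). Qed.

Lemma serve_sub N T S v : serve N T S v -> T v.
Proof. by case/andP. Qed.

Lemma leq_queue N T (S S' : pred nat) v : (forall x, S x -> S' x) ->
  queue N T S v <= queue N T S' v.
Proof.
move=> sSS'; elim/(@down_ind N): v => [v leNv|v ltvN IHv].
  by rewrite !queue_ge.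
rewrite !(queueS _ _ _ v) //; apply: leq_add; last by case: (S v) (sSS' v) => // ->.
exact: leq_sub2r.
Qed.

Lemma serve_mono N T (S S' : pred nat) v : (forall x, S x -> S' x) ->
  serve N T S v -> serve N T S' v.
Proof.
move=> sSS' /andP[Tv q_gt0]; rewrite /serve Tv /=.
exact: leq_trans q_gt0 (leq_queue _ _ _ _ _ sSS').
Qed.

Lemma queue_conservation N T S v :
  queue N T S v + count (serve N T S) (iota v (N - v))
    = count S (iota v (N - v)).
Proof.
elim/(@down_ind N): v => [v leNv|v ltvN IHv].
  by rewrite queue_ge // (eqP (_ : N - v == 0)) ?subn_eq0.
rewrite (queueS _ _ _ v) // -(subnSK ltvN) /= -IHv [serve N T S v]/serve.
by case: (T v); case: (S v) => /=; lia.
Qed.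

(** The extra customer lengthens the queue by one exactly on the values in [(z, s]]. Services
    strictly between are busy anyway, and at [z], where the queue was empty, the surplus is
    absorbed. *)
Lemma serve_add_arrival N (T S : pred nat) s z : s < N -> ~~ S s -> z < s -> T z ->
  ~~ serve N T S z -> (forall t, z < t < s -> T t -> serve N T S t) ->
  serve N T (predU1 s S) =1 predU1 z (serve N T S).
Proof.
move=> ltsN nSs ltzs Tz nz busy v.
have q0 : queue N T S z.+1 = 0.
  by move: nz; rewrite /serve Tz /=; case: (queue _ _ _ _).
have main u : queue N T (predU1 s S) u = queue N T S u + (z < u <= s).
  elim/(@down_ind N): u => [u leNu|u ltuN IHu]; first by rewrite !queue_ge //; lia.
  rewrite !(queueS _ _ _ u) // IHu /=.
  case: (ltngtP u z) => [lt_uz|lt_zu|eq_uz].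
  - by rewrite (ltn_eqF (ltn_trans lt_uz ltzs)) /= ; lia.
  - case: (ltngtP u s) => [lt_us|lt_su|->] /=; last by rewrite (negbTE nSs); lia.
      have := busy u; rewrite lt_zu lt_us /serve => /(_ isT).
      by case: (T u) => [/(_ isT) /=|_]; case: (S u); lia.
    by case: (T u); case: (S u) => /=; lia.
  - by rewrite eq_uz q0 Tz (ltn_eqF ltzs) /=; lia.
rewrite /serve /= main; case: (eqVneq v z) => [->|neq_vz] /=.
  by rewrite Tz /=; lia.
case Tv: (T v) => //=; case: (boolP (z < v.+1 <= s)) => [ltv|_]; last by rewrite addn0.
have := busy v; rewrite /serve Tv /= => -> //; lia.
Qed.

(** With no idle service below [s], the surplus customer is still waiting at the end and no further
    service gets used. *)
Lemma serve_add_lost_arrival N (T S : pred nat) s : s < N -> ~~ S s ->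
  (forall t, t < s -> T t -> serve N T S t) ->
  serve N T (predU1 s S) =1 serve N T S.
Proof.
move=> ltsN nSs busy v.
have main u : queue N T (predU1 s S) u = queue N T S u + (u <= s).
  elim/(@down_ind N): u => [u leNu|u ltuN IHu]; first by rewrite !queue_ge //; lia.
  rewrite !(queueS _ _ _ u) // IHu /=.
  case: (ltngtP u s) => [lt_us|lt_su|->] /=; last by rewrite (negbTE nSs); lia.
    have := busy u lt_us; rewrite /serve.
    by case: (T u) => [/(_ isT) /=|_]; case: (S u); lia.
  by case: (T u); case: (S u) => /=; lia.
rewrite /serve main; case Tv: (T v) => //=; case: (boolP (v < s)) => [ltvs|_]; last by rewrite addn0.
by have := busy v ltvs Tv; rewrite /serve Tv /= => ->; lia.
Qed.

Lemma last_idle N (T S : pred nat) s :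
  (forall t, t < s -> T t -> serve N T S t) \/
  exists z, [/\ z < s, T z, ~~ serve N T S z &
    forall t, z < t < s -> T t -> serve N T S t].
Proof.
pose p z := [&& z < s, T z & ~~ serve N T S z].
have [ex_p|no_p] := boolP (has p (iota 0 s)); last first.
  left=> t lt_ts Tt; apply: contraR no_p => nt; apply/hasP; exists t => //.
    by rewrite mem_iota.
  by rewrite /p lt_ts Tt.
right; have ex : exists z, p z by case/hasP: ex_p => z _ pz; exists z.
have bound z : p z -> z <= s by case/and3P => /ltnW.
case: (ex_maxnP ex bound) => z /and3P[zs Tz nz] zmax; exists z; split=> // t lt_t Tt.
apply/negPn/negP => nt; have := zmax t; rewrite /p Tt nt; lia.
Qed.

(* Both arrival sets are [A] minus [z] plus one arrival, and the latter is
   served at the same value, the last idle one below [z]. *)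
Lemma serve_swap N (T A B : pred nat) z y : y < N -> z < y -> A z -> ~~ A y ->
  B =1 [pred v | (v == y) || A v && (v != z)] ->
  (forall t, z <= t < y -> T t -> serve N T A t) ->
  serve N T B =1 serve N T A.
Proof.
move=> ltyN ltzy Az nAy eB busy.
pose A0 : pred nat := [pred v | A v && (v != z)].
have nA0z : ~~ A0 z by rewrite /A0 /= eqxx andbF.
have nA0y : ~~ A0 y by rewrite /A0 /= (negbTE nAy).
have eA : A =1 predU1 z A0 by move=> v; rewrite /A0 /=; case: eqVneq => [->|_] //=; rewrite ?andbT.
have eB' : B =1 predU1 y A0 by move=> v; rewrite eB.
have ltzN := ltn_trans ltzy ltyN.
move=> v; rewrite (eq_serve _ _ _ _ _ (frefl _) eA) (eq_serve _ _ _ _ _ (frefl _) eB').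
have busy' t : z <= t < y -> T t -> predU1 z A0 =1 A -> serve N T (predU1 z A0) t.
  by move=> ht Tt e; rewrite (eq_serve _ _ _ _ _ (frefl _) e) busy.
have {}busy' t : z <= t < y -> T t -> serve N T (predU1 z A0) t.
  by move=> ht Tt; apply: busy'.
case: (last_idle N T A0 z) => [idle|[x [ltxz Tx nx xlast]]].
  have e := serve_add_lost_arrival _ _ _ _ ltzN nA0z idle.
  rewrite e serve_add_lost_arrival // => t ltty Tt.
  by have [/idle->//|leqzt] := ltnP t z; rewrite -e busy' // leqzt.
have e := serve_add_arrival _ _ _ _ _ ltzN nA0z ltxz Tx nx xlast.
rewrite e (serve_add_arrival _ _ _ _ x) // ?(ltn_trans ltxz) // => t /andP[ltxt ltty] Tt.
have [lttz|leqzt] := ltnP t z; first by rewrite xlast // ltxt.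
have := busy' t; rewrite leqzt ltty e => /(_ isT Tt) /= /orP[/eqP etx|//].
by move: ltxt; rewrite etx ltnn.
Qed.

(** A service offered to an empty queue removes nobody, so the queue has the same length without
    it. *)
Lemma serve_del_idle N (T T' S : pred nat) y : queue N T S y.+1 = 0 ->
  T' =1 [pred v | T v && (v != y)] -> serve N T' S =1 serve N T S.
Proof.
move=> q0 eT'.
have main u : queue N T' S u = queue N T S u.
  elim/(@down_ind N): u => [u leNu|u ltuN IHu]; first by rewrite !queue_ge.
  rewrite !(queueS _ _ _ u) // IHu eT' /=; case: eqVneq => [->|_]; last by rewrite andbT.
  by rewrite q0 !sub0n.
move=> v; rewrite /serve main eT' /=; case: eqVneq => [->|_]; last by rewrite andbT.
by rewrite q0 !andbF.
Qed.

Lemma queue_above N (T S : pred nat) g v : (forall x, S x -> x < g) -> g <= v ->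
  queue N T S v = 0.
Proof.
move=> Sg; elim/(@down_ind N): v => [v leNv _|v ltvN IHv legv]; first exact: queue_ge.
rewrite (queueS _ _ _ v) // IHv ?(leqW legv) //.
by case: (boolP (S v)) => // /Sg; lia.
Qed.

(* Until the additional service is compensated, the first queue is shorter by
   one and the second one longer by one; the second one is busy meanwhile. *)
Lemma serve_add_service N (W U U' S : pred nat) g : ~~ U g -> U' =1 predU1 g U ->
  (forall w, W w -> w < g -> serve N W [pred v | U v && (v < g)] w) ->
  serve N W (serve N U' S) =1 serve N W (serve N U S).
Proof.
move=> nUg eU' busy.
(* [rho] is the second queue when fed with all services of [U] below [g]. During the deviation the
   first queue is nonempty, so all these services are indeed used; hence [rho] stays below [r], and
   [busy] carries over to [r]. *)
set rho := queue N W [pred v | U v && (v < g)].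
have rho0 v : g <= v -> rho v = 0.
  by apply: queue_above => x /andP[].
set q := queue N U S; set q' := queue N U' S.
set r := queue N W (serve N U S); set r' := queue N W (serve N U' S).
have main v : q v = q' v /\ r v = r' v \/
    [/\ v <= g, q v = (q' v).+1, r' v = (r v).+1 & rho v <= r v].
  elim/(@down_ind N): v => [v leNv|v ltvN IHv].
    by left; rewrite /q /q' /r /r' !queue_ge.
  have := rho0 v; have := rho0 v.+1; have := busy v.
  rewrite /q /q' /r /r' /rho /serve !(queueS _ _ _ v) // -!/(serve _ _ _).
  rewrite -/q -/q' -/r -/r' -/rho /= !eU' /= /serve.
  rewrite -/q -/q' -/r -/r' -/rho /=.
  move: IHv => [] [].
    move=> -> ->; case: (ltngtP v g) => [ltvg|ltgv|evg] /=; [by left|by left|].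
    rewrite evg (negbTE nUg) /= => _ -> // _.
    case: (q' g.+1) => [|k]; first by left; split; lia.
    by right; split; lia.
  move=> lt_vg -> -> le_rho; rewrite (ltn_eqF lt_vg) lt_vg /=.
  move=> /[swap] _ /[swap] _; case: (W v) => /= [/(_ isT isT) rho_gt0|_].
    case: (U v) => /=; last by right; split; lia.
    by case: (q' v.+1) => [|k]; [left|right]; split; lia.
  case: (U v) => /=; last by right; split; lia.
  by case: (q' v.+1) => [|k]; [left|right]; split; lia.
move=> w; rewrite /serve -/r -/r' -!/(serve _ _ _).
case Ww: (W w) => //=; rewrite -/r -/r'.
have [[_ ->]//|[ltwg _ -> ler]] := main w.+1.
by have := busy w Ww ltwg; rewrite /serve Ww /= -/rho; lia.
Qed.

(** * Comparing queues with matchings of arrivals and services *)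

Definition crossing (lo hi : nat -> nat) (ks : seq nat) (v : nat) : nat :=
  count (fun k => lo k < v <= hi k) ks.

(** Scanning downwards, the interval [(lo k, hi k]] is entered at [hi k] and left at [lo k]; this is
    the recursion of a queue that wastes no service. *)
Lemma crossingS (lo hi : nat -> nat) (ks : seq nat) v : {in ks, forall k, lo k < hi k} ->
  crossing lo hi ks v + count_mem v (map lo ks)
    = crossing lo hi ks v.+1 + count_mem v (map hi ks).
Proof.
rewrite /crossing; elim: ks => //= k ks IHks lt_lohi.
have lt_k := lt_lohi k (mem_head _ _).
have {}IHks := IHks (fun j hj => lt_lohi j (mem_behead (s := k :: ks) hj)).
have : (lo k < v <= hi k) + (lo k == v) = (lo k < v.+1 <= hi k) + (hi k == v) by lia.
by move: IHks; set a := count _ ks; set b := count _ ks; lia.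
Qed.

Lemma leq_count_crossing (lo hi : nat -> nat) (ks : seq nat) v :
  {in ks, forall k, lo k < hi k} ->
  count_mem v (map lo ks) <= crossing lo hi ks v.+1.
Proof.
move=> lt_lohi; rewrite count_map.
rewrite (@eq_in_count _ _ (predI (fun k => lo k < v.+1 <= hi k) (preim lo (pred1 v)))).
  by apply: sub_count => k /andP[].
move=> k k_ks /=; case: eqP => [<-|_]; last by rewrite andbF.
by rewrite ltnS leqnn lt_lohi.
Qed.

(* Every arrival [hi k] can be assigned its own service [lo k < hi k]. *)
Lemma queue_empty N (T S : pred nat) (lo hi : nat -> nat) (ks : seq nat) n :
  {in ks, forall k, lo k < hi k} -> uniq (map lo ks) ->
  {in ks, forall k, n <= lo k} -> {in ks, forall k, T (lo k)} ->
  (forall s, n <= s -> S s -> s \in map hi ks) -> queue N T S n = 0.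
Proof.
move=> lt_lohi uniq_lo le_lo T_lo S_hi.
have main v : n <= v -> queue N T S v <= crossing lo hi ks v.
  elim/(@down_ind N): v => [v leNv _|v ltvN IHv lenv]; first by rewrite queue_ge.
  have := IHv (leqW lenv); have := crossingS lo hi ks v lt_lohi; rewrite (queueS _ _ _ v) //.
  have : count_mem v (map lo ks) <= T v.
    rewrite count_uniq_mem //; case: (boolP (v \in _)) => //= /mapP[k k_ks ->].
    by rewrite T_lo.
  have : S v <= count_mem v (map hi ks).
    case: (boolP (S v)) => //= Sv.
    by rewrite -has_count has_pred1 S_hi.
  have := leq_count_crossing lo hi ks v lt_lohi.
  lia.
(* The intervals are open at [lo k], which is at least [n], so none of them contains [n]. *)
apply/eqP; rewrite -leqn0; apply: leq_trans (main n (leqnn n)) _.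
rewrite leqNgt -has_count; apply/hasPn => k k_ks.
by rewrite negb_and -leqNgt le_lo.
Qed.

(** Dual to [queue_empty]: here the crossing number bounds the queue from below. Just before the
    service [lo k] the interval of [k] is still open, so somebody is waiting. *)
Lemma serve_busy N (W A : pred nat) (lo hi : nat -> nat) (ks : seq nat) g : g <= N ->
  {in ks, forall k, lo k < hi k} -> {in ks, forall k, hi k < g} ->
  {in ks, forall k, A (hi k)} -> uniq (map hi ks) ->
  (forall w, W w -> w < g -> w \in map lo ks) ->
  forall w, W w -> w < g -> serve N W [pred v | A v && (v < g)] w.
Proof.
move=> legN lt_lohi hi_g A_hi uniq_hi W_lo.
have cross0 v : g <= v -> crossing lo hi ks v = 0.
  move=> legv; apply/eqP; rewrite -leqn0 leqNgt -has_count; apply/hasPn => k k_ks.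
  by rewrite negb_and -!ltnNge; have := hi_g k k_ks; lia.
have main v : crossing lo hi ks v <= queue N W [pred v | A v && (v < g)] v.
  elim/(@down_ind N): v => [v leNv|v ltvN IHv]; first by rewrite cross0 // (leq_trans legN).
  have [legv|ltvg] := leqP g v; first by rewrite cross0.
  move: IHv; have := crossingS lo hi ks v lt_lohi; rewrite (queueS _ _ _ v) //= ltvg andbT.
  have : count_mem v (map hi ks) <= A v.
    rewrite count_uniq_mem //; case: (boolP (v \in _)) => //= /mapP[k k_ks ->].
    by rewrite A_hi.
  have : W v <= count_mem v (map lo ks).
    case: (boolP (W v)) => //= Wv.
    by rewrite -has_count has_pred1 W_lo.
  move: (queue _ _ _ _) (crossing _ _ _ v.+1) (crossing _ _ _ v) (count_mem _ _).
  move: (count_mem _ _) => a b cr d e.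
  lia.
move=> w Ww ltwg; rewrite /serve Ww /=; apply: leq_trans (main _).
have /mapP[k k_ks ->] := W_lo w Ww ltwg.
by rewrite -has_count; apply/hasP; exists k => //; rewrite ltnS leqnn lt_lohi.
Qed.

(** * Queues in tandem *)

Fixpoint tandem (N : nat) (A : nat -> pred nat) (j : nat) (S : pred nat) : pred nat :=
  if j is j'.+1 then tandem N A j' (serve N (A j') S) else S.

Definition keypred (N : nat) (A : nat -> pred nat) (j : nat) : pred nat :=
  tandem N A j (A j).

Lemma eq_tandem N (A B : nat -> pred nat) j (S S' : pred nat) :
  (forall i, i < j -> A i =1 B i) -> S =1 S' ->
  tandem N A j S =1 tandem N B j S'.
Proof.
elim: j S S' => //= j IHj S S' eAB eS.
apply: IHj => [i lt_ij|]; first exact/eAB/ltnW.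
by apply: eq_serve => //; apply: eAB.
Qed.

Lemma eq_keypred N (A B : nat -> pred nat) j : (forall i, A i =1 B i) -> keypred N A j =1 keypred N B j.
Proof. by move=> eAB; apply: eq_tandem. Qed.

(** Keys to the left of [c] do not involve column [c]. Those to its right enter columns [c, ..., 0]
    with a subset of column [c.+1]: that column itself or the services used in it. *)
Lemma eq_keypred_off N (A B : nat -> pred nat) c : (forall i, i != c -> A i =1 B i) ->
  (forall S : pred nat, (forall v, S v -> A c.+1 v) ->
     tandem N A c.+1 S =1 tandem N B c.+1 S) ->
  forall j, j != c -> keypred N A j =1 keypred N B j.
Proof.
move=> eAB eS j; rewrite neq_ltn => /orP[lt_jc|lt_cj].
  by apply: eq_tandem => [i lt_ij|]; apply: eAB; lia.
have eAB' i : c < i -> A i =1 B i by move=> lt_ci; apply: eAB; lia.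
suff main n (S : pred nat) : (n = 0 -> forall v, S v -> A c.+1 v) ->
    tandem N A (c.+1 + n) S =1 tandem N B (c.+1 + n) S.
  have -> : j = c.+1 + (j - c.+1) by lia.
  move=> v; rewrite /keypred main; last by move=> ->; rewrite addn0.
  by apply: eq_tandem => // ; apply: eAB'; lia.
elim: n S => [|n IHn] S HS; first by rewrite addn0; apply/eS/HS.
rewrite addnS => v; set d := c.+1 + n.
rewrite -[LHS]/(tandem N A d (serve N (A d) S) v).
rewrite -[RHS]/(tandem N B d (serve N (B d) S) v) IHn; last first.
  by rewrite /d => -> u /serve_sub; rewrite addn0.
by apply: eq_tandem => //; apply: eq_serve => //; apply: eAB'; rewrite /d; lia.
Qed.

Lemma serve_card N (T S : pred nat) : queue N T S 0 = 0 ->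
  count (serve N T S) (iota 0 N) = count S (iota 0 N).
Proof. by move=> q0; have := queue_conservation N T S 0; rewrite q0 subn0. Qed.

(** Here [y] is the least arrival of [B] missing from [A], and [z] is the last service below [y]
    left idle by [B] without [y]. It is idle for the smaller set [A] too, and [y] is the arrival
    that makes it used. *)
Lemma serve_min N (T A B : pred nat) y : (forall v, A v -> B v) -> y < N -> B y -> ~~ A y ->
  (forall v, v < y -> B v -> A v) -> queue N T B 0 = 0 ->
  exists z, [/\ serve N T B z, ~~ serve N T A z,
     forall v, v < z -> serve N T B v -> serve N T A v &
     serve N T [pred v | B v && (v != y)] =1 [pred v | serve N T B v && (v != z)]].
Proof.
move=> sAB ltyN By nAy minB q0.
pose B0 : pred nat := [pred v | B v && (v != y)].
have nB0y : ~~ B0 y by rewrite /B0 /= eqxx andbF.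
have eB : B =1 predU1 y B0 by move=> v; rewrite /B0 /=; case: eqVneq => [->|_] //=; rewrite ?andbT.
have card_B : count B (iota 0 N) = (count B0 (iota 0 N)).+1.
  rewrite (eq_count eB); have := count_predUI (pred1 y) B0 (iota 0 N).
  rewrite (@eq_count _ (predI _ _) pred0) ?count_pred0; last first.
    by move=> v; rewrite /B0 /=; case: eqVneq => //= _; rewrite andbF.
  rewrite count_uniq_mem ?iota_uniq // mem_iota /= ltyN addn0 => ->.
  by rewrite add1n.
have eT : T =1 T by [].
case: (last_idle N T B0 y) => [idle|[z [ltzy Tz nz zlast]]].
  (* In this case [y] would be lost, whereas by [q0] every arrival of [B] is served: the counts
     differ by one. *)
  have e := serve_add_lost_arrival _ _ _ _ ltyN nB0y idle.
  have := serve_card N T B q0; rewrite card_B.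
  rewrite (eq_count (eq_serve _ _ _ _ _ eT eB)) (eq_count e).
  have := queue_conservation N T B0 0; rewrite subn0; lia.
have e := serve_add_arrival _ _ _ _ _ ltyN nB0y ltzy Tz nz zlast.
have {}e : serve N T B =1 predU1 z (serve N T B0).
  by move=> v; rewrite (eq_serve _ _ _ _ _ eT eB) e.
have sAB0 v : A v -> B0 v.
  by move=> Av; rewrite /B0 /= sAB //=; apply: contraNneq nAy => <-.
exists z; split; first by rewrite e /= eqxx.
- by apply: contra nz; apply: serve_mono.
(* Both queues are empty once [z] is reached, and below [y] the two arrival sets coincide, so the
   queues agree from there on. *)
- have q0' : queue N T B0 z.+1 = 0 by move: nz; rewrite /serve Tz; case: queue.
  have q0A : queue N T A z.+1 = 0.
    by apply/eqP; rewrite -leqn0 -q0'; apply: leq_queue.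
  have main v : v <= z -> queue N T A v = queue N T B0 v.
    elim/(@down_ind N): v => [v leNv _|v ltvN IHv]; first by rewrite !queue_ge.
    rewrite leq_eqVlt => /orP[/eqP ->|ltvz].
      rewrite !(queueS _ _ _ z) ?(ltn_trans ltzy) // q0' q0A /=; congr (_ + nat_of_bool _).
      by apply/idP/idP => [/sAB0//|/andP[Bz _]]; apply: minB.
    rewrite !(queueS _ _ _ v) // IHv //; congr (_ + nat_of_bool _).
    by apply/idP/idP => [/sAB0//|/andP[Bz _]]; apply: minB => //; lia.
  move=> v ltvz; rewrite e /= (ltn_eqF ltvz) /= /serve => /andP[-> /=].
  by rewrite main.
move=> v; rewrite /= e /=; case: eqVneq => [->|_] /=; last by rewrite andbT.
by rewrite (negbTE nz).
Qed.

(** Iteration of [serve_min]: each queue turns a least discrepancy of its arrivals into a least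
    discrepancy of its used services. *)
Lemma tandem_min N (A : nat -> pred nat) j (S S' : pred nat) y :
  (forall i v, A i v -> v < N) ->
  (forall i (X : pred nat), i < j -> (forall v, X v -> A i.+1 v) -> queue N (A i) X 0 = 0) ->
  (forall v, S' v -> A j v) ->
  (forall v, S v -> S' v) -> S' y -> ~~ S y ->
  (forall v, v < y -> S' v -> S v) ->
  exists z, [/\ tandem N A j S' z, ~~ tandem N A j S z,
     forall v, v < z -> tandem N A j S' v -> tandem N A j S v &
     tandem N A j [pred v | S' v && (v != y)]
       =1 [pred v | tandem N A j S' v && (v != z)]].
Proof.
elim: j S S' y => [|j IHj] S S' y AN q0 S'A sS S'y nSy minS /=; first by exists y.
have [||z [z1 z2 z3 z4]] := serve_min N (A j) S S' y sS _ S'y nSy minS.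
- exact: AN (S'A _ S'y).
- by apply: q0.
have [||||||w [w1 w2 w3 w4]] := IHj (serve N (A j) S) (serve N (A j) S') z AN.
- by move=> i X lt_ij; apply: q0; apply: ltnW.
- by move=> v /serve_sub.
- by move=> v; apply: serve_mono.
- exact: z1.
- exact: z2.
- exact: z3.
exists w; split=> // v; rewrite -w4.
exact: eq_tandem.
Qed.

(** * Keys of tableaux *)

Lemma bigmax_mem (s : seq nat) : s != [::] -> \max_(x <- s) x \in s.
Proof.
elim: s => // x [|y s] IHs _; first by rewrite big_seq1 mem_head.
rewrite big_cons; have := IHs isT; set m := \max_(_ <- _) _ => m_s.
by case: (leqP x m) => _; rewrite inE ?m_s ?orbT ?eqxx.
Qed.

Definition seqpred (s : seq nat) : pred nat := fun v => v \in s.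

(** The picked elements are the services used by the arrivals treated so far, and the available ones
    are the idle services. By [serve_add_arrival] a new arrival activates the largest idle service
    below it, which is exactly the greedy choice. *)
Lemma foldl_tri_serve N (T l done avail picked : seq nat) :
  uniq l -> {in l, forall s, s \notin done} -> {in l, forall s, s < N} ->
  uniq avail -> uniq picked ->
  (forall v, v \in avail = (v \in T) && ~~ serve N (seqpred T) (seqpred done) v) ->
  (forall v, v \in picked = serve N (seqpred T) (seqpred done) v) ->
  let st := foldl tri_step (avail, picked) l in
  uniq st.2 /\
  forall v, v \in st.2 = serve N (seqpred T) (seqpred (rev l ++ done)) v.
Proof.
elim: l done avail picked => [|s l IHl] done avail picked; first by [].
move=> uniq_sl sl_done sl_N uniq_a uniq_p mem_a mem_p.
have /andP[nsl uniq_l] : (s \notin l) && uniq l by [].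
have nsd : ~~ seqpred done s by apply: sl_done; rewrite mem_head.
have lt_sN : s < N by apply: sl_N; rewrite mem_head.
have l_done : {in l, forall t, t \notin s :: done}.
  move=> t t_l; rewrite inE negb_or sl_done ?inE ?t_l ?orbT // andbT.
  by apply: contraNneq nsl => <-.
have l_N : {in l, forall t, t < N} by move=> t t_l; apply: sl_N; rewrite inE t_l orbT.
have eS : seqpred (s :: done) =1 predU1 s (seqpred done).
  by move=> v; rewrite /seqpred inE.
rewrite rev_cons cat_rcons [foldl _ _ _]/=.
case Ecs: [seq x <- avail | x < s] => [|c cs].
  apply: IHl => // v.
    rewrite mem_a (eq_serve _ _ _ _ _ (frefl _) eS) serve_add_lost_arrival // => t ltts Tt.
    apply: contraT => nt.
    have : t \in [seq x <- avail | x < s] by rewrite mem_filter ltts mem_a nt andbT.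
    by rewrite Ecs.
  rewrite mem_p (eq_serve _ _ _ _ _ (frefl _) eS) serve_add_lost_arrival // => t ltts Tt.
  apply: contraT => nt.
  have : t \in [seq x <- avail | x < s] by rewrite mem_filter ltts mem_a nt andbT.
  by rewrite Ecs.
set z := \max_(y <- c :: cs) y.
have z_cs : z \in c :: cs by apply: bigmax_mem.
move: (z_cs); rewrite -Ecs mem_filter mem_a => /and3P[ltzs Tz nz].
have zlast t : z < t < s -> seqpred T t -> serve N (seqpred T) (seqpred done) t.
  case/andP=> ltzt ltts Tt; apply: contraT => nt.
  have t_cs : t \in c :: cs by rewrite -Ecs mem_filter ltts mem_a nt andbT.
  by have := leq_bigmax_seq (F := id) t t_cs isT; rewrite leqNgt ltzt.
have e v : serve N (seqpred T) (seqpred (s :: done)) v =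
    predU1 z (serve N (seqpred T) (seqpred done)) v.
  rewrite (eq_serve _ _ _ _ _ (frefl _) eS); exact: serve_add_arrival.
apply: IHl => //.
- exact: rem_uniq.
- by rewrite /= uniq_p mem_p nz.
- move=> v; rewrite mem_rem_uniq // inE /= mem_a e /= negb_or.
  by case: (v == z); rewrite ?andbF.
by move=> v; rewrite inE mem_p e.
Qed.

Lemma serve_nil N (T : pred nat) v : serve N T (seqpred [::]) v = false.
Proof. by rewrite /serve (@queue_above _ _ _ 0) ?andbF. Qed.

Lemma triP N (T S : seq nat) : uniq T -> {in S, forall s, s < N} ->
  sorted ltn (tri T S) /\
  seqpred (tri T S) =1 serve N (seqpred T) (seqpred S).
Proof.
move=> uniq_T S_N; rewrite /tri.
have [||||||| uniq_p mem_p] :=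
    foldl_tri_serve N T (sort geq (undup S)) [::] T [::].
- by rewrite sort_uniq undup_uniq.
- by [].
- by move=> s; rewrite mem_sort mem_undup; apply: S_N.
- exact: uniq_T.
- by [].
- by move=> u; rewrite serve_nil andbT.
- by move=> u; rewrite serve_nil.
split.
  rewrite ltn_sorted_uniq_leq sort_uniq uniq_p sort_sorted //; exact: leq_total.
move=> v; rewrite /seqpred mem_sort mem_p.
apply: eq_serve => // u; rewrite /seqpred cats0 mem_rev mem_sort.
exact: mem_undup.
Qed.

(** * Cells, columns and entries of strict tableaux *)

Definition colpred (P : tableau) (j : nat) : pred nat := fun v => v \in col P j.

(** Phrased cell by cell, so that it can be checked entry by entry after a replacement or a
    deletion. *)
Definition strict_tableau (P : tableau) : Prop :=
  [/\ forall i j, is_cell P i.+1 j -> is_cell P i j,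
      forall i j, is_cell P i j.+1 -> entry P i j < entry P i j.+1 &
      forall i j, is_cell P i.+1 j -> entry P i j < entry P i.+1 j].

Lemma is_cell_ltn_size P i j : is_cell P i j -> i < size P.
Proof.
by apply: contraTT; rewrite -leqNgt /is_cell /trow => /(nth_default [::]) ->.
Qed.

Lemma is_cell_left P i j j' : j' <= j -> is_cell P i j -> is_cell P i j'.
Proof. exact: leq_ltn_trans. Qed.

Lemma col_entry P j :
  col P j = [seq entry P i j | i <- iota 0 (size P) & is_cell P i j].
Proof.
by rewrite /col -{1}[P](mkseq_nth [::]) /mkseq filter_map -map_comp.
Qed.

Lemma colpredP P j v :
  reflect (exists2 i, is_cell P i j & entry P i j = v) (colpred P j v).
Proof.
rewrite /colpred col_entry; apply: (iffP mapP) => [[i]|[i ij ev]].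
  by rewrite mem_filter => /andP[ij _] ->; exists i.
by exists i => //; rewrite mem_filter ij mem_iota (is_cell_ltn_size _ _ _ ij).
Qed.

Lemma increasing_strict P : increasing_tableau P -> strict_tableau P.
Proof.
case=> /andP[_ sorted_P] _ rows_P cols_P; split=> // i j; rewrite /is_cell.
  have [lt_iP|] := ltnP i.+1 (size P); last first.
    by move=> le_Pi; rewrite {1}/trow nth_default.
  move/(sortedP 0)/(_ i): sorted_P; rewrite size_map => /(_ lt_iP).
  rewrite !(nth_map [::]) ?(ltnW lt_iP) // /trow => le_size lt_j.
  exact: leq_trans lt_j le_size.
move=> ltj; have lt_iP := is_cell_ltn_size P i _ ltj.
have /(sortedP 0) := allP rows_P _ (mem_nth [::] lt_iP).
exact.
Qed.

Lemma entry_bound P i j :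
  is_cell P i j -> entry P i j < (\max_(x <- flatten P) x).+1.
Proof.
move=> cell; rewrite ltnS; apply: (leq_bigmax_seq (F := id)) => //.
apply/flattenP; exists (trow P i); last exact: mem_nth.
by rewrite mem_nth // (is_cell_ltn_size _ _ _ cell).
Qed.

Section StrictTableau.

Context (P : tableau) (hP : strict_tableau P).

Lemma is_cell_up i i' j : i' <= i -> is_cell P i j -> is_cell P i' j.
Proof.
case: hP => up _ _; elim: i => [|i IHi]; first by rewrite leqn0 => /eqP->.
by rewrite leq_eqVlt => /orP[/eqP->//|]; rewrite ltnS => /IHi IH /up.
Qed.

Lemma ltn_entry_row i j j' : j < j' -> is_cell P i j' -> entry P i j < entry P i j'.
Proof.
case: hP => _ row _; elim: j' => // j' IHj'.
rewrite ltnS leq_eqVlt => /orP[/eqP->|lt_j] cell; first exact: row.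
by apply: ltn_trans (row _ _ cell); apply: IHj' => //; apply: is_cell_left cell.
Qed.

Lemma leq_entry_row i j j' : j <= j' -> is_cell P i j' -> entry P i j <= entry P i j'.
Proof.
by rewrite leq_eqVlt => /orP[/eqP->//|lt_j] /(ltn_entry_row _ _ _ lt_j)/ltnW.
Qed.

Lemma ltn_entry_col i i' j : i < i' -> is_cell P i' j -> entry P i j < entry P i' j.
Proof.
case: hP => up _ colP; elim: i' => // i' IHi'.
rewrite ltnS leq_eqVlt => /orP[/eqP->|lt_i] cell; first exact: colP.
by apply: ltn_trans (colP _ _ cell); apply: IHi' => //; apply: up.
Qed.

Lemma leq_entry_col i i' j : i <= i' -> is_cell P i' j -> entry P i j <= entry P i' j.
Proof.
by rewrite leq_eqVlt => /orP[/eqP->//|lt_i] /(ltn_entry_col _ _ _ lt_i)/ltnW.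
Qed.

Lemma filter_iota_cell j :
  [seq i <- iota 0 (size P) | is_cell P i j] = iota 0 (size (col P j)).
Proof.
rewrite col_entry size_map; set n := size P.
elim: n => // n IHn; rewrite -addn1 iotaD add0n cats1 filter_rcons.
case: ifP => // cell; rewrite size_rcons (all_filterP _) ?size_iota.
  by rewrite -addn1 iotaD add0n cats1.
apply/allP => i; rewrite mem_iota add0n => /andP[_ lt_in].
exact: is_cell_up (ltnW lt_in) cell.
Qed.

Lemma is_cell_col i j : is_cell P i j = (i < size (col P j)).
Proof.
have : (i \in [seq i <- iota 0 (size P) | is_cell P i j]) = is_cell P i j.
  by rewrite mem_filter mem_iota; case: (boolP (is_cell P i j)) => // /is_cell_ltn_size->.
by rewrite filter_iota_cell mem_iota => <-.
Qed.

Lemma col_mkseq j : col P j = mkseq (fun i => entry P i j) (size (col P j)).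
Proof. by rewrite {1}col_entry filter_iota_cell. Qed.

Lemma col_sorted j : sorted ltn (col P j).
Proof.
apply/(sortedP 0) => i lt_i; rewrite col_mkseq !nth_mkseq ?(ltnW lt_i) //.
by apply: ltn_entry_col => //; rewrite is_cell_col.
Qed.

Lemma col_uniq j : uniq (col P j).
Proof. by have := col_sorted j; rewrite ltn_sorted_uniq_leq => /andP[]. Qed.

Lemma uniq_map_entry (ks : seq nat) j : uniq ks ->
  {in ks, forall k, is_cell P k j} -> uniq [seq entry P k j | k <- ks].
Proof.
move=> uniq_ks cells; rewrite map_inj_in_uniq // => k k' /cells ck /cells ck' ekk'.
case: (ltngtP k k') => // lt_k.
  by have := ltn_entry_col _ _ _ lt_k ck'; rewrite ekk' ltnn.
by have := ltn_entry_col _ _ _ lt_k ck; rewrite ekk' ltnn.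
Qed.

(** Each entry of column [c.+1] is matched with its left neighbour in the same row, so every
    customer is served. *)
Lemma queue_col_empty N c (S : pred nat) : (forall v, S v -> colpred P c.+1 v) ->
  queue N (colpred P c) S 0 = 0.
Proof.
move=> S_V; pose ks := iota 0 (size (col P c.+1)).
have cell k : k \in ks -> is_cell P k c.+1.
  by rewrite mem_iota is_cell_col.
apply: (queue_empty _ _ _ (fun k => entry P k c) (fun k => entry P k c.+1) ks) => //.
- by move=> k /cell; apply: ltn_entry_row.
- by apply: uniq_map_entry; rewrite ?iota_uniq // => k /cell; apply: is_cell_left.
- by move=> k /cell cell_k; apply/colpredP; exists k => //; apply: is_cell_left cell_k.
move=> s _ /S_V/colpredP[k cell_k <-]; apply/mapP; exists k => //.
by rewrite mem_iota /= -is_cell_col.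
Qed.

Lemma keycolP N j : (forall i v, colpred P i v -> v < N) ->
  sorted ltn (keycol P j) /\ seqpred (keycol P j) =1 keypred N (colpred P) j.
Proof.
move=> col_N; rewrite /keycol /keypred.
have : {in col P j, forall v, v < N} by move=> v; apply: col_N.
rewrite -[colpred P j]/(seqpred (col P j)); move: (col P j) (col_sorted j).
elim: j => [|j IHj] S sorted_S S_N; first by [].
have -> : iota 0 j.+1 = rcons (iota 0 j) j by rewrite -addn1 iotaD add0n cats1.
rewrite foldr_rcons /=.
have uj : undup (col P j) = col P j by apply/undup_id/col_uniq.
have [sorted_tri tri_eq] := triP N (undup (col P j)) S (undup_uniq _) S_N.
have tri_N : {in tri (undup (col P j)) S, forall v, v < N}.
  move=> v; rewrite -/(seqpred _ v) tri_eq uj => /serve_sub; exact: col_N.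
have [-> eqS] := IHj _ sorted_tri tri_N; split=> // v; rewrite eqS.
by apply: eq_tandem => // u; rewrite tri_eq uj.
Qed.

Lemma count_tandem N j (S : pred nat) : (forall v, S v -> colpred P j v) ->
  count (tandem N (colpred P) j S) (iota 0 N) = count S (iota 0 N).
Proof.
elim: j S => //= j IHj S S_V; rewrite IHj; last by move=> v /serve_sub.
by apply: serve_card; apply: queue_col_empty.
Qed.

(** No customer is lost in any of the queues, so the key column is as long as the column it starts
    from. *)
Lemma size_keycol j : size (keycol P j) = size (col P j).
Proof.
pose N := (\max_(x <- flatten P) x).+1.
have col_N i v : colpred P i v -> v < N.
  by case/colpredP=> k cell_k <-; apply: entry_bound.
have card s : uniq s -> {in s, forall v, v < N} -> size s = count (seqpred s) (iota 0 N).
  move=> uniq_s s_N; rewrite -size_filter; apply/perm_size/uniq_perm => //.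
    by rewrite filter_uniq ?iota_uniq.
  move=> v; rewrite mem_filter mem_iota /= /seqpred.
  by case: (boolP (v \in s)) => // /s_N->.
have [sorted_key key_eq] := keycolP N j col_N.
have uniq_key : uniq (keycol P j).
  by move: sorted_key; rewrite ltn_sorted_uniq_leq => /andP[].
have sub_col i (S : pred nat) v : (forall u, S u -> u < N) ->
    tandem N (colpred P) i S v -> v < N.
  elim: i S => [|i IHi] S S_N /=; first exact: S_N.
  by apply: IHi => u /serve_sub; apply: col_N.
rewrite card //; last first.
  by move=> v; rewrite -/(seqpred _ v) key_eq; apply/sub_col/col_N.
rewrite (eq_count key_eq) count_tandem // -card ?col_uniq //.
by move=> v; apply: col_N.
Qed.

(** By [size_keycol] the key columns fill the shape of [P] exactly, so the default value of [nth] is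
    never read inside it. *)
Lemma col_leftkey j : col (leftkey P) j = keycol P j.
Proof.
have trow_key i : trow (leftkey P) i =
    [seq nth 0 (keycol P j) i | j <- iota 0 (size (trow P i))].
  have [lt_iP|le_Pi] := ltnP i (size P).
    by rewrite {1}/trow (nth_map 0) ?size_iota // nth_iota.
  by rewrite /trow !nth_default // size_map size_iota.
have cell i k : is_cell (leftkey P) i k = is_cell P i k.
  by rewrite /is_cell trow_key size_map size_iota.
rewrite col_entry size_map size_iota (eq_filter (fun i => cell i j)) filter_iota_cell.
rewrite -size_keycol -[RHS](mkseq_nth 0); apply/eq_in_map => i.
rewrite mem_iota size_keycol /= add0n -is_cell_col => cell_ij.
by rewrite /entry trow_key (nth_map 0) ?size_iota // nth_iota.
Qed.

End StrictTableau.

(** * Local modifications of a tableau *)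

Lemma entry_default P i j : ~~ is_cell P i j -> entry P i j = 0.
Proof. by rewrite -leqNgt => le; rewrite /entry nth_default. Qed.

Section Replace.

Context (P : tableau) (i c g : nat).
Context (hP : strict_tableau P) (cell_ic : is_cell P i c).
Let Q := replace_in_row P i (entry P i c) g.

Lemma trow_replace k : k != i -> trow Q k = trow P k.
Proof. by move=> neq_ki; rewrite /trow nth_set_nth /= (negbTE neq_ki). Qed.

Lemma trow_replace_same :
  trow Q i = [seq (if y == entry P i c then g else y) | y <- trow P i].
Proof. by rewrite {1}/trow nth_set_nth /= eqxx. Qed.

Lemma size_replace : size Q = size P.
Proof. by rewrite size_set_nth; apply/maxn_idPr/(is_cell_ltn_size _ _ _ cell_ic). Qed.

Lemma is_cell_replace k j : is_cell Q k j = is_cell P k j.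
Proof.
rewrite /is_cell; have [->|/trow_replace->//] := eqVneq k i.
by rewrite trow_replace_same size_map.
Qed.

(** [replace_in_row] acts on every occurrence of a value, but a strict row contains it only once. *)
Lemma entry_replace k j :
  entry Q k j = if (k == i) && (j == c) then g else entry P k j.
Proof.
have [->|neq_ki] /= := eqVneq k i; last by rewrite /entry trow_replace.
have [cell_ij|ncell] := boolP (is_cell P i j); last first.
  rewrite entry_default ?is_cell_replace // entry_default //.
  by case: eqP => // ejc; move: cell_ic; rewrite -ejc (negbTE ncell).
rewrite {1}/entry trow_replace_same (nth_map 0) // -/(entry P i j).
case: (ltngtP j c) => [lt_jc|lt_cj|->]; last by rewrite eqxx.
  by rewrite (ltn_eqF (ltn_entry_row _ hP _ _ _ lt_jc cell_ic)).
by rewrite (gtn_eqF (ltn_entry_row _ hP _ _ _ lt_cj cell_ij)).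
Qed.

Lemma colpred_replace_off j : j != c -> colpred Q j =1 colpred P j.
Proof.
move=> neq_jc v; apply/colpredP/colpredP => -[k cell ev]; exists k => //.
- by rewrite -is_cell_replace.
- by move: ev; rewrite entry_replace (negbTE neq_jc) andbF.
- by rewrite is_cell_replace.
by rewrite entry_replace (negbTE neq_jc) andbF.
Qed.

Lemma colpred_replace :
  colpred Q c =1 [pred u | (u == g) || colpred P c u && (u != entry P i c)].
Proof.
move=> v; apply/idP/idP => /= [/colpredP[k]|].
  rewrite is_cell_replace entry_replace eqxx andbT => cell_k <-.
  have [_|neq_ki] := eqVneq k i; first by rewrite eqxx.
  apply/orP; right; apply/andP; split; first by apply/colpredP; exists k.
  case: (ltngtP k i) neq_ki => // lt_ki _.
    by rewrite ltn_eqF // ltn_entry_col.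
  by rewrite gtn_eqF // ltn_entry_col.
case/predU1P=> [->|/andP[/colpredP[k cell_k <-] neq]].
  by apply/colpredP; exists i; rewrite ?is_cell_replace // entry_replace !eqxx.
apply/colpredP; exists k; rewrite ?is_cell_replace // entry_replace eqxx andbT.
by have [eki|//] := eqVneq k i; move: neq; rewrite eki eqxx.
Qed.

Lemma strict_replace : entry P i c < g ->
  (is_cell P i c.+1 -> g < entry P i c.+1) ->
  (is_cell P i.+1 c -> g < entry P i.+1 c) -> strict_tableau Q.
Proof.
move=> lt_g lt_row lt_col; have [up row colP] := hP; split=> k j.
- by rewrite !is_cell_replace; apply: up.
- rewrite is_cell_replace !entry_replace => cell.
  case: eqVneq cell => [->|_] cell /=; last exact: row.
  case: (eqVneq j c) cell => [->|_] cell; first by rewrite gtn_eqF ?lt_row.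
  case: eqVneq cell => [e|_] cell; last exact: row.
  by apply: ltn_trans lt_g; rewrite -e; apply: row.
rewrite is_cell_replace !entry_replace => cell.
case: (eqVneq j c) cell => [->|_] cell; rewrite ?andbF ?andbT; last exact: colP.
case: (eqVneq k i) cell => [->|_] cell; first by rewrite gtn_eqF ?lt_col.
case: eqVneq cell => [e|_] cell; last exact: colP.
by apply: ltn_trans lt_g; rewrite -e; apply: colP.
Qed.

End Replace.

(** The empty rows are all at the bottom, so removing them does not renumber the others. *)
Lemma trow_filter_nonempty (Q : tableau) :
  (forall k, trow Q k = [::] -> trow Q k.+1 = [::]) ->
  forall k, trow [seq rw <- Q | rw != [::]] k = trow Q k.
Proof.
elim: Q => //= rw Q IHQ empty k.
have {}IHQ : forall k, trow [seq rw <- Q | rw != [::]] k = trow Q k.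
  by apply: IHQ => j; apply: (empty j.+1).
case: eqVneq => [rw0|_] /=; last by case: k => //= k; apply: IHQ.
have all0 j : trow (rw :: Q) j = [::] by elim: j => // j; apply: empty.
by rewrite IHQ all0; apply: (all0 k.+1).
Qed.

Section Delete.

Context (P : tableau) (r c : nat).
Context (hP : strict_tableau P) (out_rc : outer_cell P r c).
Let Q := delete_cell P r c.

Lemma trow_delete k : trow Q k = if k == r then take c (trow P r) else trow P k.
Proof.
case/and3P: out_rc => cell_rc ncell_down ncell_right.
have row_delete j : trow (set_nth [::] P r (take c (trow P r))) j =
    if j == r then take c (trow P r) else trow P j.
  by rewrite /trow nth_set_nth.
rewrite /Q /delete_cell trow_filter_nonempty ?row_delete // => j.
have empty j' : trow P j' = [::] -> trow P j'.+1 = [::].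
  move=> e; apply/nilP; rewrite /nilp; case: posnP => // cell0.
  by have := is_cell_up _ hP _ _ 0 (leqnSn j') cell0; rewrite /is_cell e.
rewrite !row_delete; have [->|neq_jr] := eqVneq j r.
  rewrite gtn_eqF // => e; apply/nilP; rewrite /nilp; case: posnP => // cell0.
  (* Deleting the cell can only empty a row of length one; the row below is then empty because the
     cell is outer. *)
  have c0 : c = 0.
    have := congr1 size e; rewrite size_take -/(is_cell P r c) cell_rc.
    by [].
  by rewrite c0 in ncell_down; case/negP: ncell_down.
move=> /empty e; case: eqP e => // ->; rewrite -/(trow P r) => e.
by rewrite e.
Qed.

Lemma is_cell_delete k j : is_cell Q k j = is_cell P k j && ~~ ((k == r) && (j == c)).
Proof.
case/and3P: out_rc => cell_rc ncell_down ncell_right.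
rewrite /is_cell trow_delete; have [->|_] /= := eqVneq k r; last by rewrite andbT.
rewrite size_take -/(is_cell P r c) cell_rc.
move: ncell_right cell_rc; rewrite /is_cell; lia.
Qed.

Lemma entry_delete k j : is_cell Q k j -> entry Q k j = entry P k j.
Proof.
rewrite is_cell_delete /entry trow_delete; have [->|//] := eqVneq k r.
case/and3P: out_rc => cell_rc ncell_down ncell_right.
move=> /= /andP[cell neq]; rewrite nth_take //.
move: neq cell ncell_right; rewrite /is_cell; lia.
Qed.

Lemma strict_delete : strict_tableau Q.
Proof.
case/and3P: out_rc => cell_rc ncell_down ncell_right.
have [up row colP] := hP; split=> k j cell; last first.
- rewrite !entry_delete //; first by move: cell; rewrite is_cell_delete => /andP[/colP].
  move: cell; rewrite !is_cell_delete => /andP[cell _]; rewrite up //=.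
  by apply: contraNN ncell_down => /andP[/eqP<- /eqP<-].
- rewrite !entry_delete //; first by move: cell; rewrite is_cell_delete => /andP[/row].
  exact: is_cell_left cell.
move: cell; rewrite !is_cell_delete => /andP[cell _]; rewrite up //=.
by apply: contraNN ncell_down => /andP[/eqP<- /eqP<-].
Qed.

End Delete.

(** * Bumping paths *)

Section Path.

Context (P : tableau) (r c : nat).
Context (hP : strict_tableau P) (out_rc : outer_cell P r c).
Let pcol i := bump_col P r c (r - i).
Let pval i := bump_val P r c i.

Lemma bump_col_spec i : i < r -> is_cell P i.+1 (pcol i.+1) ->
  [/\ is_cell P i (pcol i), pval i < pval i.+1 &
      forall j, is_cell P i j -> entry P i j < pval i.+1 -> j <= pcol i].
Proof.
move=> lt_ir cell; rewrite /pval /bump_val -/(pcol i) -/(pcol i.+1).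
have eq_d : r - i = (r - i.+1).+1 by rewrite subnSK.
pose p (j : 'I_(size (trow P i))) := entry P i j < entry P i.+1 (pcol i.+1).
have -> : pcol i = \max_(j | p j) val j.
  by rewrite {1}/pcol eq_d /= -eq_d subKn ?(ltnW lt_ir) // subKn.
have [up _ colP] := hP.
have cell_j : pcol i.+1 < size (trow P i) by apply: up.
(* The cell directly above the path qualifies, so the maximum is attained and is not the default
   0. *)
have pj : p (Ordinal cell_j) by apply: colP.
rewrite (bigmax_eq_arg (Ordinal cell_j) pj); case: arg_maxnP => // jm pjm jmax.
split=> //; first exact: ltn_ord.
by move=> j lt_j lt_e; apply: (jmax (Ordinal lt_j)).
Qed.

Lemma path_end : pcol r = c.
Proof. by rewrite /pcol subnn. Qed.

Lemma path_cell i : i <= r -> is_cell P i (pcol i).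
Proof.
move=> le_ir; rewrite -(subKn le_ir); elim: (r - i) (leq_subr i r) => [|d IHd] le_d.
  by rewrite subn0 path_end; case/and3P: out_rc.
have eq_d : r - d = (r - d.+1).+1 by lia.
have := IHd (ltnW le_d); rewrite eq_d => /bump_col_spec[] //; lia.
Qed.

Lemma path_ltn i : i < r -> pval i < pval i.+1.
Proof. by move=> lt_ir; case: (bump_col_spec i lt_ir (path_cell _ lt_ir)). Qed.

Lemma path_max i j : i < r -> is_cell P i j -> entry P i j < pval i.+1 -> j <= pcol i.
Proof. by move=> lt_ir; case: (bump_col_spec i lt_ir (path_cell _ lt_ir)) => _ _; apply. Qed.

Lemma path_col_leq i : i < r -> pcol i.+1 <= pcol i.
Proof.
move=> lt_ir; have [up _ colP] := hP; have cell := path_cell _ lt_ir.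
by apply: path_max => //; [apply: up|apply: colP].
Qed.

End Path.

(** * Reverse row insertion *)

Section ReverseInsertion.

Context (P : tableau) (r c N : nat) (alpha : bool).
Context (hP : strict_tableau P) (out_rc : outer_cell P r c).
Context (entry_N : forall i j, is_cell P i j -> entry P i j < N).

Let pcol i := bump_col P r c (r - i).
Let pval i := bump_val P r c i.

(** A condition on a family [K] rather than on one tableau: during an ejection the correct keys come
    partly from the refilled columns and partly from the current ones. *)
Definition expected_keys (K : nat -> pred nat) : Prop :=
  if alpha then
    (forall j, j != c -> K j =1 keypred N (colpred P) j) /\
    exists mn, [/\ keypred N (colpred P) c mn, ~~ keypred N (colpred P) c.+1 mn,
      (forall v, v < mn -> keypred N (colpred P) c v ->
         keypred N (colpred P) c.+1 v) &
      K c =1 [pred v | keypred N (colpred P) c v && (v != mn)]]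
  else forall j, K j =1 keypred N (colpred P) j.

Lemma eq_expected_keys (K K' : nat -> pred nat) :
  (forall j, K j =1 K' j) -> expected_keys K -> expected_keys K'.
Proof.
rewrite /expected_keys => eK; case: alpha => [[off [mn [k1 k2 k3 k4]]]|eP].
  split=> [j neq v|]; first by rewrite -eK off.
  by exists mn; split=> // v; rewrite -eK k4.
by move=> j v; rewrite -eK eP.
Qed.

(** That entries only grow later locates a value below the path value of its row to the left of the
    path. The number of rows is recorded separately because the cells do not see trailing empty
    rows. *)
Record processed (n : nat) (Q : tableau) : Prop := Processed {
  proc_strict : strict_tableau Q;
  proc_above : forall k, k < n -> trow Q k = trow P k;
  proc_cell : forall k j,
    is_cell Q k j = is_cell P k j && ~~ [&& alpha, k == r & j == c];
  proc_geq : forall k j, is_cell Q k j -> entry P k j <= entry Q k j;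
  proc_bound : forall k j, is_cell Q k j -> entry Q k j < N;
  proc_size : ~~ alpha -> size Q = size P }.

Definition settled (Q : tableau) : Prop := expected_keys (keypred N (colpred Q)).

Definition refilled (n : nat) (Q : tableau) : nat -> pred nat :=
  fun j v => (j == pcol n) && (v == pval n) || colpred Q j v.

Definition ejected (n : nat) (Q : tableau) : Prop :=
  ~~ colpred Q (pcol n) (pval n) /\
  (is_cell Q n (pcol n) -> pval n < entry Q n (pcol n)).

(* While the ejected value moves up inside one column, the keys of the later
   columns are right with that value put back, and the key of the column itself
   is right without it. The last clause makes the next move harmless. *)
Definition open_ejection (n : nat) (Q : tableau) : Prop :=
  exists K, [/\ expected_keys K,
    forall j, j != pcol n -> keypred N (refilled n Q) j =1 K j,
    keypred N (colpred Q) (pcol n) =1 K (pcol n) &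
    exists2 d, pcol n = d.+1 & forall w, colpred Q d w -> w < pval n ->
      serve N (colpred Q d) (colpred Q d.+1) w].

(* Before the first ejected value leaves the column of the deleted cell, that
   column differs from the original one, and its key changes when it does. *)
Definition first_ejection (n : nat) (Q : tableau) : Prop :=
  [/\ alpha, pcol n = c & forall j, refilled n Q j =1 colpred P j].

Lemma refilled_off n Q j : j != pcol n -> refilled n Q j =1 colpred Q j.
Proof. by move=> neq v; rewrite /refilled (negbTE neq). Qed.

Lemma refilled_at n Q : refilled n Q (pcol n) =1 predU1 (pval n) (colpred Q (pcol n)).
Proof. by move=> v; rewrite /refilled eqxx. Qed.

Lemma pcell n : n <= r -> is_cell P n (pcol n).
Proof. exact: path_cell. Qed.

Lemma pval_bound n : n <= r -> pval n < N.
Proof. by move=> le_nr; apply/entry_N/pcell. Qed.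

(** * Closing an ejection once the path has left the column *)

Section Close.

Context (n : nat) (Q : tableau).
Context (le_nr : n <= r) (procQ : processed n Q) (ejQ : ejected n Q).
Context (next_le : forall k, k < n ->
  is_cell P k (pcol n).+1 /\ entry P k (pcol n).+1 <= pval n).

Let hQ := proc_strict _ _ procQ.

Lemma entry_above k j : k < n -> entry Q k j = entry P k j.
Proof. by move=> lt_kn; rewrite /entry (proc_above _ _ procQ). Qed.

Lemma ejected_ltn k : n <= k -> is_cell Q k (pcol n) -> pval n < entry Q k (pcol n).
Proof.
move=> le_nk cell_k; apply: leq_trans (leq_entry_col _ hQ _ _ _ le_nk cell_k).
by apply: (proj2 ejQ); apply: is_cell_up le_nk cell_k.
Qed.

(** By [next_le], an arrival above [pval n] lies in a row [k >= n]. Its left neighbour also exceeds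
    [pval n] and serves as its own service, so nobody is waiting when [pval n] is reached. *)
Lemma queue_ejected (S : pred nat) : (forall v, S v -> colpred Q (pcol n).+1 v) ->
  queue N (refilled n Q (pcol n)) S (pval n).+1 = 0.
Proof.
move=> S_V; set d := pcol n.
pose ks := [seq k <- iota 0 (size (col Q d.+1)) | n <= k].
have ksP k : k \in ks -> n <= k /\ is_cell Q k d.+1.
  by rewrite mem_filter mem_iota /= add0n -(is_cell_col _ hQ) => /andP[].
have cell_d k : k \in ks -> is_cell Q k d.
  by case/ksP => _; apply: is_cell_left.
apply: (queue_empty _ _ _ (fun k => entry Q k d) (fun k => entry Q k d.+1) ks).
- by move=> k /ksP[_]; apply: ltn_entry_row.
- by apply: uniq_map_entry; rewrite ?filter_uniq ?iota_uniq.
- by move=> k kks; apply: ejected_ltn; [case: (ksP _ kks)|apply: cell_d].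
- move=> k kks; rewrite refilled_at /=; apply/orP; right; apply/colpredP.
  by exists k => //; apply: cell_d.
move=> s lt_s /S_V/colpredP[k cell_k e]; apply/mapP; exists k => //.
rewrite mem_filter mem_iota /= add0n -(is_cell_col _ hQ) cell_k andbT leqNgt.
apply/negP => lt_kn; have [_] := next_le k lt_kn.
by rewrite -entry_above // e leqNgt lt_s.
Qed.

Lemma serve_refilled (S : pred nat) : (forall v, S v -> colpred Q (pcol n).+1 v) ->
  serve N (colpred Q (pcol n)) S =1 serve N (refilled n Q (pcol n)) S.
Proof.
move=> S_V; apply: serve_del_idle (queue_ejected S S_V) _ => v.
rewrite /= refilled_at /=; case: eqVneq => [->|_] /=; last by rewrite andbT.
by rewrite (negbTE (proj1 ejQ)).
Qed.

Lemma keypred_refilled j : j != pcol n ->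
  keypred N (refilled n Q) j =1 keypred N (colpred Q) j.
Proof.
apply: eq_keypred_off => [i|S S_V]; first exact: refilled_off.
apply: (eq_tandem _ _ _ (pcol n) (serve N _ S) (serve N _ S)) => [i lt_i|v].
  by apply: refilled_off; rewrite ltn_eqF.
rewrite serve_refilled // => u /S_V; rewrite refilled_off //.
by rewrite gtn_eqF.
Qed.

Lemma close_open : open_ejection n Q -> settled Q.
Proof.
case=> K [K_ok off at_c _]; apply: eq_expected_keys K_ok => j v.
have [->|neq_j] := eqVneq j (pcol n); first by rewrite at_c.
by rewrite -off // keypred_refilled.
Qed.

Lemma close_open_first : first_ejection n Q -> settled Q.
Proof.
case=> al ec eP; rewrite /settled /expected_keys al.
have eoff j : j != c -> colpred Q j =1 colpred P j.
  by move=> neq v; rewrite -eP refilled_off ?ec.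
have eat : colpred P c =1 predU1 (pval n) (colpred Q c).
  by move=> v; rewrite -eP -ec refilled_at.
split=> [j neq v|].
  rewrite -keypred_refilled ?ec //; exact: eq_keypred.
have serve_c : serve N (colpred Q c) (colpred P c.+1)
             =1 serve N (colpred P c) (colpred P c.+1).
  move=> v; have := serve_refilled (colpred P c.+1); rewrite ec => ->.
    by apply: eq_serve => // u; apply: eP.
  by move=> u; rewrite eoff ?gtn_eqF.
set y := pval n in eat.
have nSy : ~~ serve N (colpred P c) (colpred P c.+1) y.
  by rewrite -serve_c; apply/negP => /serve_sub; apply/negP; rewrite -ec; case: ejQ.
have col_N j v : colpred P j v -> v < N by case/colpredP => k cell <-; apply: entry_N.
have minS v : v < y -> colpred P c v -> serve N (colpred P c) (colpred P c.+1) v.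
  move=> lt_vy cv.
  rewrite -serve_c.
  have Qv : colpred Q c v by move: cv; rewrite eat /= (ltn_eqF lt_vy).
  (* The bound is [y.+1] because the entries of column [c.+1] in the rows above [n] may equal
     [y]. *)
  apply: (@serve_mono _ _ [pred u | colpred P c.+1 u && (u < y.+1)]) => [u /andP[]//|].
  apply: (serve_busy _ _ _ (fun k => entry P k c) (fun k => entry P k c.+1) (iota 0 n)) => //.
  - exact: pval_bound.
  - move=> k; rewrite mem_iota /= add0n => /next_le[]; rewrite ec => cell _.
    exact: ltn_entry_row.
  - by move=> k; rewrite mem_iota /= add0n => /next_le[]; rewrite ec.
  - move=> k; rewrite mem_iota /= add0n => /next_le[]; rewrite ec => cell _.
    by apply/colpredP; exists k.
  - apply: uniq_map_entry; rewrite ?iota_uniq // => k; rewrite mem_iota /= add0n.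
    by case/next_le; rewrite ec.
  - move=> w /colpredP[k cell_k <-] le_w; apply/mapP; exists k.
      rewrite mem_iota /= add0n ltnNge; apply/negP => le_nk.
      by have := ejected_ltn k le_nk; rewrite ec => /(_ cell_k); rewrite ltnNge -ltnS le_w.
    rewrite entry_above //; rewrite ltnNge; apply/negP => le_nk.
    by have := ejected_ltn k le_nk; rewrite ec => /(_ cell_k); rewrite ltnNge -ltnS le_w.
  exact: ltnW.
have Py : colpred P c y by rewrite eat /= eqxx.
(* Keys [c] and [c.+1] both come out of the tandem of columns below [c], fed with column [c] and
   with its used services respectively. *)
have [||||||z [z1 z2 z3 z4]] := tandem_min N (colpred P) c
    (serve N (colpred P c) (colpred P c.+1)) (colpred P c) y col_N.
- by move=> i X _; apply: queue_col_empty.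
- by [].
- by move=> v /serve_sub.
- exact: Py.
- exact: nSy.
- exact: minS.
exists z; split=> // v; rewrite -z4; apply: eq_tandem => [i lt_ic|u].
  by apply: eoff; rewrite ltn_eqF.
rewrite /= eat /=; case: eqVneq => [->|_] /=; last by rewrite andbT.
by rewrite /y -ec (negbTE (proj1 ejQ)).
Qed.

End Close.

(** * Replacing the path entry of one row *)

Section Replacement.

Context (i : nat) (Q : tableau) (g : nat).
Context (le_ir : i <= r) (procQ : processed i.+1 Q).
Context (lt_g : pval i < g) (lt_gN : g < N).
Context (lt_g_right : is_cell P i (pcol i).+1 -> g < entry P i (pcol i).+1).
Context (lt_g_below : is_cell Q i.+1 (pcol i) -> g < entry Q i.+1 (pcol i)).

Let hQ := proc_strict _ _ procQ.
Let Q' := replace_in_row Q i (pval i) g.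

Lemma proc_row j : is_cell Q i j = is_cell P i j.
Proof. by rewrite /is_cell (proc_above _ _ procQ). Qed.

Lemma proc_entry j : entry Q i j = entry P i j.
Proof. by rewrite /entry (proc_above _ _ procQ). Qed.

Lemma proc_pcell : is_cell Q i (pcol i).
Proof. by rewrite proc_row pcell. Qed.

Lemma proc_pval : entry Q i (pcol i) = pval i.
Proof. exact: proc_entry. Qed.

Lemma entry_replaced k j :
  entry Q' k j = if (k == i) && (j == pcol i) then g else entry Q k j.
Proof. by rewrite /Q' -proc_pval (entry_replace _ _ _ _ hQ) ?proc_pcell. Qed.

Lemma cell_replaced k j : is_cell Q' k j = is_cell Q k j.
Proof. by rewrite /Q' -proc_pval is_cell_replace. Qed.

Lemma col_replaced_off j : j != pcol i -> colpred Q' j =1 colpred Q j.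
Proof. by rewrite /Q' -proc_pval; apply: colpred_replace_off => //; apply: proc_pcell. Qed.

Lemma col_replaced : colpred Q' (pcol i)
  =1 [pred u | (u == g) || colpred Q (pcol i) u && (u != pval i)].
Proof. by rewrite /Q' -proc_pval; apply: colpred_replace => //; apply: proc_pcell. Qed.

Lemma processed_replace : processed i Q'.
Proof.
have [_ above cells geq bound sz] := procQ; split.
- rewrite /Q' -proc_pval; apply: strict_replace => //; rewrite ?proc_pcell ?proc_pval //.
  by rewrite proc_row proc_entry.
- by move=> k lt_ki; rewrite /Q' -proc_pval trow_replace ?above ?(leqW lt_ki) // ltn_eqF.
- by move=> k j; rewrite cell_replaced cells.
- move=> k j; rewrite cell_replaced entry_replaced => cell.
  by case: andP => [[/eqP-> /eqP->]|_]; [apply: ltnW|apply: geq].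
- move=> k j; rewrite cell_replaced entry_replaced => cell.
  by case: ifP => _ //; apply: bound.
by move=> /sz <-; rewrite /Q' -proc_pval size_replace ?proc_pcell.
Qed.

Lemma ejected_replace : ejected i Q'.
Proof.
split; last by rewrite entry_replaced !eqxx.
by rewrite col_replaced /= eqxx andbF orbF neq_ltn lt_g.
Qed.

Lemma refilled_replace : refilled i Q' (pcol i) =1 predU1 g (colpred Q (pcol i)).
Proof.
move=> v; rewrite refilled_at /= col_replaced /=.
case: (eqVneq v (pval i)) => [->|_]; last by rewrite andbT.
rewrite /= (_ : colpred Q _ _ = true) ?orbT //; apply/colpredP; exists i.
  exact: proc_pcell.
exact: proc_pval.
Qed.

(** Entries of column [d] below [g] lie in rows up to [i] and are matched with their right
    neighbours, which are at most [pval i]; so column [d] is busy below [g]. Then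
    [serve_add_service] handles the refilled column, and [serve_swap] the exchange of [pval i] for
    [g] among the arrivals. *)
Lemma open_replace d : settled Q -> pcol i = d.+1 ->
  (is_cell Q i.+1 d -> g <= entry Q i.+1 d) -> open_ejection i Q'.
Proof.
move=> Q_ok ed g_left; exists (keypred N (colpred Q)).
set W := colpred Q d; set U := colpred Q d.+1.
have W_g w : W w -> w < g -> exists2 k, k <= i & is_cell Q k d /\ entry Q k d = w.
  case/colpredP=> k cell_k <- lt_w; exists k => //.
  rewrite leqNgt; apply/negP => lt_ik.
  have := g_left (is_cell_up _ hQ _ _ _ lt_ik cell_k).
  have := leq_entry_col _ hQ _ _ _ lt_ik cell_k; lia.
have cell_U k : k <= i -> is_cell Q k d.+1.
  by move=> le_ki; apply: is_cell_up le_ki _ => //; rewrite -ed proc_pcell.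
have U_le k : k <= i -> entry Q k d.+1 <= pval i.
  by move=> le_ki; rewrite -proc_pval ed; apply: leq_entry_col => //; apply: cell_U.
have nUg : ~~ U g.
  apply/negP => /colpredP[k cell_k e].
  have [le_ki|lt_ik] := leqP k i; first by have := U_le k le_ki; rewrite e leqNgt lt_g.
  move: lt_g_below; rewrite ed => /(_ (is_cell_up _ hQ _ _ _ lt_ik cell_k)).
  have := leq_entry_col _ hQ _ _ _ lt_ik cell_k; lia.
have busy : forall w, W w -> w < g -> serve N W [pred v | U v && (v < g)] w.
  apply: (serve_busy _ _ _ (fun k => entry Q k d) (fun k => entry Q k d.+1) (iota 0 i.+1)).
  - exact: ltnW.
  - move=> k; rewrite mem_iota /= add0n ltnS => /cell_U; exact: ltn_entry_row.
  - by move=> k; rewrite mem_iota /= add0n ltnS => /U_le le; apply: leq_ltn_trans lt_g.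
  - move=> k; rewrite mem_iota /= add0n ltnS => le_ki; apply/colpredP; exists k => //.
    exact: cell_U.
  - apply: uniq_map_entry; rewrite ?iota_uniq // => k.
    by rewrite mem_iota /= add0n ltnS => /cell_U.
  move=> w Ww lt_w; have [k le_ki [_ <-]] := W_g w Ww lt_w.
  by apply/mapP; exists k => //; rewrite mem_iota /= add0n ltnS.
have eW : colpred Q' d =1 W by apply: col_replaced_off; rewrite ed ltn_eqF.
have eU : colpred Q' d.+1 =1 [pred u | (u == g) || U u && (u != pval i)].
  by move=> v; rewrite -ed col_replaced ed.
have Um : U (pval i).
  by apply/colpredP; exists i; rewrite -ed ?proc_pval ?proc_pcell.
have swap : serve N (colpred Q' d) (colpred Q' d.+1) =1 serve N W U.
  move=> v; rewrite (eq_serve _ _ _ _ _ eW (frefl _)).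
  (* The busy condition is vacuous: column [d] has no entry from [pval i] up to [g]. *)
  apply: (serve_swap _ _ _ _ (pval i) g) => // t /andP[le_t lt_tg] Wt.
  have [k le_ki [cell_k e]] := W_g t Wt lt_tg.
  have := ltn_entry_row _ hQ _ _ _ (ltnSn d) (cell_U k le_ki).
  have := U_le k le_ki; rewrite e; lia.
split=> //.
- move=> j neq v; symmetry; move: j neq v; apply: eq_keypred_off => [j neq v|S _].
    by rewrite refilled_off // col_replaced_off.
  rewrite ed.
  apply: (eq_tandem _ _ _ d (serve N _ (serve N _ S)) (serve N _ (serve N _ S))) => [j lt_j u|u].
    by rewrite refilled_off ?col_replaced_off // ed ltn_eqF // leqW.
  have eW' : refilled i Q' d =1 W.
    by move=> x; rewrite refilled_off ?col_replaced_off // ed ltn_eqF.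
  rewrite [in RHS](eq_serve _ _ _ _ _ eW' (frefl _)); symmetry.
  by apply: (serve_add_service _ _ _ _ _ g) => //; rewrite -ed; apply: refilled_replace.
- rewrite ed.
  apply: (eq_tandem _ _ _ d (serve N _ _) (serve N _ _)) => // j lt_j.
  by apply: col_replaced_off; rewrite ed ltn_eqF // leqW.
exists d => // w; rewrite eW swap => Ww lt_w.
have lt_wg := ltn_trans lt_w lt_g.
by apply: serve_mono (busy w Ww lt_wg) => v /andP[].
Qed.

Lemma refilled_slide : pcol i = pcol i.+1 -> g = pval i.+1 ->
  forall j, refilled i Q' j =1 refilled i.+1 Q j.
Proof.
move=> ec eg j; have [->|neq] := eqVneq j (pcol i).
  by move=> v; rewrite refilled_replace eg ec refilled_at.
by move=> v; rewrite !refilled_off -?ec // col_replaced_off.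
Qed.

Lemma open_first_slide : pcol i = pcol i.+1 -> g = pval i.+1 ->
  first_ejection i.+1 Q -> first_ejection i Q'.
Proof.
move=> ec eg [al e_c eP]; split; [by []|by rewrite ec|].
by move=> j v; rewrite refilled_slide // eP.
Qed.

(** The refilled columns do not change, so only the key of the path's own column needs an argument:
    its arrival [pval i] is exchanged for [g], and the last clause of [open_ejection] at [i.+1]
    keeps the services in between busy. *)
Lemma open_slide : pcol i = pcol i.+1 -> g = pval i.+1 ->
  ~~ colpred Q (pcol i) g -> open_ejection i.+1 Q -> open_ejection i Q'.
Proof.
move=> ec eg nUg [K [K_ok off at_c [d ed busy]]]; rewrite -ec in off at_c ed.
have eW : colpred Q' d =1 colpred Q d.
  by apply: col_replaced_off; rewrite ed ltn_eqF.
have swap : serve N (colpred Q' d) (colpred Q' d.+1)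
         =1 serve N (colpred Q d) (colpred Q d.+1).
  move=> v; rewrite (eq_serve _ _ _ _ _ eW (frefl _)).
  apply: (serve_swap _ _ _ _ (pval i) g) => //.
  - apply/colpredP; exists i; rewrite -ed ?proc_pval ?proc_pcell //.
  - by rewrite -ed.
  - by move=> u; rewrite -ed col_replaced ed.
  by move=> t /andP[_]; rewrite eg => lt_t Wt; apply: busy.
exists K; split=> //.
- move=> j neq v; rewrite -off //; apply: eq_keypred; exact: refilled_slide.
- move=> v; rewrite -at_c ed; move: v.
  apply: (eq_tandem _ _ _ d (serve N _ _) (serve N _ _)) => // j lt_j.
  by apply: col_replaced_off; rewrite ed ltn_eqF // leqW.
exists d => // w; rewrite eW swap => Ww lt_w; apply: busy => //.
by rewrite -eg; apply: ltn_trans lt_g.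
Qed.

End Replacement.

(** With [a] true there is either a pending ejection or, after a row left alone by rule (D), a
    settled tableau; the membership then remembers why that row was left alone. *)
Definition state (n : nat) (Q : tableau) (a : bool) : Prop :=
  processed n Q /\
  if a then ejected n Q /\ (open_ejection n Q \/ first_ejection n Q) \/
            settled Q /\ (pval n).+1 \in trow P n
  else settled Q.

Lemma processed_leq n Q : processed n.+1 Q -> processed n Q.
Proof. by case=> h1 h2 h3 h4 h5 h6; split=> // k lt_kn; apply/h2/leqW. Qed.

Lemma mem_trow i v :
  reflect (exists2 j, is_cell P i j & entry P i j = v) (v \in trow P i).
Proof. exact: nthP. Qed.

(** Such an entry bounds, through the rows and columns of [P], all entries of the column after
    [pcol i.+1] in rows up to [i]: the path has left its column, and a pending ejection can be
    closed. *)
Lemma settled_step i Q j : i < r -> state i.+1 Q true ->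
  is_cell P i j -> pcol i.+1 < j -> entry P i j <= pval i.+1 -> settled Q.
Proof.
move=> lt_ir [procQ st] cell_j lt_j le_e; case: st => [[ejQ st]|[]//].
have next_le k : k < i.+1 ->
    is_cell P k (pcol i.+1).+1 /\ entry P k (pcol i.+1).+1 <= pval i.+1.
  rewrite ltnS => le_ki; have cell_i := is_cell_left _ _ _ _ lt_j cell_j.
  split; first exact: is_cell_up le_ki cell_i.
  apply: leq_trans (leq_entry_col _ hP _ _ _ le_ki cell_i) _.
  exact: leq_trans (leq_entry_row _ hP _ _ _ lt_j cell_j) le_e.
by case: st; [apply: close_open|apply: close_open_first].
Qed.

Lemma ltn_pcol i j : i <= r -> is_cell P i j -> pval i < entry P i j -> pcol i < j.
Proof.
move=> le_ir cell lt_e; rewrite ltnNge; apply/negP => le_j.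
have := leq_entry_row _ hP _ _ _ le_j (pcell i le_ir).
by rewrite leqNgt lt_e.
Qed.

(** The second alternative is the first pass for [alpha = 0], in row [r] with an infinite next
    value. *)
Definition next_value (i : nat) (a : bool) (mnext : option nat) : Prop :=
  i < r /\ mnext = Some (pval i.+1) \/
  [/\ i = r, ~~ alpha, a = false & mnext = None].

Lemma insert_step i Q a mnext : processed i.+1 Q -> settled Q ->
  next_value i a mnext ->
  let cs := [seq x <- trow Q i.+1 | [&& pval i < x, lt_opt x mnext
                                       & ejectable (drop i.+1 Q) x]] in
  let st := if cs is [::] then (Q, false)
            else (replace_in_row Q i (pval i) (\max_(x <- cs) x), true) in
  state i st.1 st.2.
Proof.
move=> procQ Q_ok next cs st.
have [cs0|cs_n0] := eqVneq cs [::].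
  by rewrite /st cs0; split; first exact: processed_leq.
have := bigmax_mem _ cs_n0; set g := \max_(x <- cs) x.
rewrite {1}/cs mem_filter => /andP[/and3P[lt_g lt_next _]].
have -> /= : st = (replace_in_row Q i (pval i) g, true).
  by rewrite /st -/g; case: (cs) cs_n0.
case/(nthP 0) => j0 cell_j0 ej0.
have {}cell_j0 : is_cell Q i.+1 j0 by [].
have {}ej0 : entry Q i.+1 j0 = g by [].
have hQ := proc_strict _ _ procQ.
have le_ir : i <= r by case: next => [[/ltnW]|[->]].
have lt_j0 : j0 < pcol i.
  case: next => [[lt_ir en]|[ei nal _ _]]; last first.
    rewrite ei /pcol (path_end P r c) ltnNge; apply/negP => le_j0.
    case/and3P: out_rc => _ /negP[]; apply: is_cell_left le_j0 _.
    by move: cell_j0; rewrite (proc_cell _ _ procQ) ei => /andP[].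
  (* Entries have only grown, so from column [pcol i.+1] on, row [i.+1] of [Q] has no value below
     [pval i.+1]. *)
  apply: leq_trans (path_col_leq P r c hP out_rc i lt_ir).
  rewrite ltnNge; apply/negP => le_j0.
  have cell_p := is_cell_left _ _ _ _ le_j0 cell_j0.
  have := leq_trans (proc_geq _ _ procQ _ _ cell_p)
                    (leq_entry_row _ hQ _ _ _ le_j0 cell_j0).
  by rewrite ej0 leqNgt; move: lt_next; rewrite en /= => ->.
have lt_gN : g < N by rewrite -ej0; apply: (proc_bound _ _ procQ).
have lt_right : is_cell P i (pcol i).+1 -> g < entry P i (pcol i).+1.
  move=> cell; case: next => [[lt_ir en]|[ei nal _ _]]; last first.
    by move: cell; rewrite ei /pcol (path_end P r c); case/and3P: out_rc => _ _ /negP.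
  move: lt_next; rewrite en /= => lt_next; apply: leq_trans lt_next _.
  rewrite leqNgt; apply/negP => lt_e.
  by have := path_max P r c hP out_rc i _ lt_ir cell lt_e; rewrite ltnn.
have lt_below : is_cell Q i.+1 (pcol i) -> g < entry Q i.+1 (pcol i).
  by rewrite -ej0; apply: ltn_entry_row.
split; first exact: processed_replace.
left; split; first exact: ejected_replace.
left; apply: (open_replace _ _ _ _ _ _ _ _ _ (pcol i).-1) => //.
  by rewrite prednK //; apply: leq_trans lt_j0.
rewrite -ej0; apply: leq_entry_row => //; lia.
Qed.

(** If the path stays in its column, the pending ejection slides up; if it moves right, that
    ejection is closed and [pval i.+1] opens a new one. *)
Lemma direct_step i Q : i < r -> state i.+1 Q true ->
  pval i.+1 \notin trow P i ->
  state i (replace_in_row Q i (pval i) (pval i.+1)) true.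
Proof.
move=> lt_ir st nR; have [procQ _] := st.
have hQ := proc_strict _ _ procQ.
have le_ir := ltnW lt_ir.
have lt_g := path_ltn P r c hP out_rc i lt_ir.
have lt_gN := pval_bound i.+1 lt_ir.
have lt_right : is_cell P i (pcol i).+1 -> pval i.+1 < entry P i (pcol i).+1.
  move=> cell; rewrite ltnNge leq_eqVlt; apply/negP => /orP[/eqP e|lt_e].
    by case/mem_trow: nR; exists (pcol i).+1.
  by have := path_max P r c hP out_rc i _ lt_ir cell lt_e; rewrite ltnn.
have := path_col_leq P r c hP out_rc i lt_ir; rewrite -/(pcol _) -/(pcol _).
rewrite leq_eqVlt => /orP[/eqP ec|lt_c].
  case: (st) => _ [[ejQ op]|[_ /mem_trow[j cell_j ej]]].
    have lt_below : is_cell Q i.+1 (pcol i) -> pval i.+1 < entry Q i.+1 (pcol i).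
      by rewrite -ec; case: ejQ.
    split; first exact: processed_replace.
    left; split; first exact: ejected_replace.
    case: op => [op|op]; [left|right].
      by apply: open_slide => //; rewrite -ec; case: ejQ.
    exact: open_first_slide.
  (* A settled tableau is impossible here: above the value [(pval i.+1).+1], row [i] has an entry at
     most [pval i.+1] to the right of the path, whereas those entries exceed [pval i.+1]. *)
  have lt_j : pcol i < j by rewrite -ec; apply: ltn_pcol => //; rewrite ej.
  have [up _ colP] := hP.
  have cell_r := is_cell_left _ _ _ _ lt_j (up _ _ cell_j).
  have := lt_right cell_r.
  have := leq_entry_row _ hP _ _ _ lt_j (up _ _ cell_j).
  have := colP _ _ cell_j; rewrite ej; lia.
(* The path cell of row [i] itself shows that the path has left the column [pcol i.+1]. *)
have Q_ok := settled_step i Q (pcol i) lt_ir st (pcell i le_ir) lt_c (ltnW lt_g).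
have Q_geq j : pcol i.+1 <= j -> is_cell Q i.+1 j ->
    entry P i.+1 j <= entry Q i.+1 j /\ is_cell P i.+1 j.
  move=> _ cell; split; first exact: (proc_geq _ _ procQ).
  by move: cell; rewrite (proc_cell _ _ procQ) => /andP[].
have lt_below : is_cell Q i.+1 (pcol i) -> pval i.+1 < entry Q i.+1 (pcol i).
  case/(Q_geq _ (ltnW lt_c)) => le_e cell; apply: leq_trans le_e.
  exact: ltn_entry_row.
split; first exact: processed_replace.
left; split; first exact: ejected_replace.
left; apply: (open_replace _ _ _ _ _ _ _ _ _ (pcol i).-1) => //.
  by rewrite prednK //; apply: leq_trans lt_c.
have le_c : pcol i.+1 <= (pcol i).-1 by lia.
case/(Q_geq _ le_c) => le_e cell; apply: leq_trans le_e.
exact: leq_entry_row.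
Qed.

Lemma row_step i Q a mnext : state i.+1 Q a -> next_value i a mnext ->
  let st := rri_row P r c i Q a mnext in state i st.1 st.2.
Proof.
move=> st next; have [procQ stQ] := st; rewrite /rri_row -/(pval i).
have le_ir : i <= r by case: next => [[/ltnW]|[->]].
case: ifP => [/mem_trow[j cell_j ej]|nD].
  split; first exact: processed_leq.
  case: a st stQ next => // st _ [[lt_ir en]|[]//]; right; split; last first.
    by apply/mem_trow; exists j.
  (* Rule (D): the value [(pval i).+1] lies right of the path and is at most [pval i.+1], so a
     pending ejection closes here. *)
  apply: (settled_step i Q j lt_ir st cell_j); last first.
    by rewrite ej; apply: path_ltn.
  apply: leq_ltn_trans (path_col_leq P r c hP out_rc i lt_ir) _.
  by apply: ltn_pcol => //; rewrite ej.
case: a st stQ next => [st _|st Q_ok] next; last exact: insert_step next.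
case: (next) => [[lt_ir en]|[]//]; rewrite en in next *; cbv iota.
have [nvR|vR] := boolP (pval i.+1 \notin trow P i).
  exact: direct_step.
apply: insert_step next => //.
have /mem_trow[j cell_j ej] : pval i.+1 \in trow P i by rewrite -[_ \in _]negbK.
(* An occurrence of [pval i.+1] in row [i] lies right of the path, so the ejection closes before a
   new value is inserted. *)
apply: (settled_step i Q j lt_ir st cell_j); last by rewrite ej.
apply: leq_ltn_trans (path_col_leq P r c hP out_rc i lt_ir) _.
by apply: ltn_pcol => //; rewrite ej; apply: path_ltn.
Qed.

Lemma loop_state n Q a : n <= r -> state n Q a ->
  exists a', state 0 (rri_loop P r c n Q a (Some (pval n))) a'.
Proof.
elim: n Q a => [|n IHn] Q a le_nr st /=; first by exists a.
apply: IHn; first exact: ltnW.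
by apply: row_step => //; left.
Qed.

Lemma state0_settled Q a : state 0 Q a -> settled Q.
Proof.
case=> procQ; case: a => // -[[ejQ op]|[]//].
by case: op; [apply: close_open|apply: close_open_first].
Qed.

Lemma state_delete : alpha -> state r (delete_cell P r c) true.
Proof.
move=> al; have cells := is_cell_delete P r c hP out_rc.
have entries := entry_delete P r c hP out_rc.
have ec : pcol r = c by apply: path_end.
have er : pval r = entry P r c by rewrite /pval /bump_val -/(pcol r) ec.
split.
  split.
  - exact: strict_delete.
  - by move=> k lt_kr; rewrite (trow_delete P r c hP out_rc) ltn_eqF.
  - by move=> k j; rewrite cells al.
  - by move=> k j /entries->.
  - move=> k j cell; rewrite entries //; apply: entry_N.
    by move: cell; rewrite cells => /andP[].
  by rewrite al.
have ejQ : ejected r (delete_cell P r c).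
  rewrite /ejected ec er; split; last by rewrite cells !eqxx andbF.
  apply/negP => /colpredP[k cell]; rewrite entries // => e.
  move: cell; rewrite cells eqxx andbT => /andP[cell neq].
  have cell_r : is_cell P r c by case/and3P: out_rc.
  case: (ltngtP k r) neq => // lt_k _.
    by have := ltn_entry_col _ hP _ _ _ lt_k cell_r; rewrite e ltnn.
  by have := ltn_entry_col _ hP _ _ _ lt_k cell; rewrite e ltnn.
left; split=> //; right; split=> // j v; rewrite /refilled ec er.
apply/idP/colpredP => [/orP[/andP[/eqP-> /eqP->]|/colpredP[k cell <-]]|[k cell <-]].
- by exists r => //; case/and3P: out_rc.
- by exists k; rewrite ?entries //; move: cell; rewrite cells => /andP[].
have [/andP[/eqP-> /eqP->]|neq] := boolP ((k == r) && (j == c)); first by rewrite !eqxx.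
have cell' : is_cell (delete_cell P r c) k j by rewrite cells cell neq.
by apply/orP; right; apply/colpredP; exists k; rewrite ?entries.
Qed.

Lemma insertion_settled :
  let Q := (reverse_row_insertion P r c alpha).1 in processed 0 Q /\ settled Q.
Proof.
rewrite /reverse_row_insertion /=.
suff [a' st] : exists a', state 0 (if alpha
    then rri_loop P r c r (delete_cell P r c) true (Some (bump_val P r c r))
    else rri_loop P r c r.+1 P false None) a'.
  by split; [case: st|apply: state0_settled st].
have [al|nal] := boolP alpha.
  by apply: loop_state => //; apply: state_delete.
apply: loop_state => //; apply: row_step; last by right.
split; last by rewrite /settled /expected_keys (negbTE nal).
by split=> // k j; rewrite (negbTE nal) andbT.
Qed.

End ReverseInsertion.

Theorem theorem6p8 (P : tableau) (R C : nat) (alpha : bool) :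
  increasing_tableau P -> outer_cell P R C ->
  let P' := (reverse_row_insertion P R C alpha).1 in
  (alpha = false -> leftkey P' = leftkey P) /\
  (alpha = true ->
     (forall j, j != C -> col (leftkey P') j = col (leftkey P) j) /\
     exists mn : nat,
       [/\ mn \in col (leftkey P) C, mn \notin col (leftkey P) C.+1,
           (forall y, y \in col (leftkey P) C -> y \notin col (leftkey P) C.+1 ->
              mn <= y) &
           col (leftkey P') C =i
             [pred y | (y \in col (leftkey P) C) && (y != mn)]]).
Proof.
move=> /increasing_strict hP out_RC P'.
pose N := (\max_(x <- flatten P) x).+1.
have entry_N i j : is_cell P i j -> entry P i j < N by apply: entry_bound.
have [[hP' _ cells _ bound sz] ok] := insertion_settled P R C N alpha hP out_RC entry_N.
rewrite -/P' in hP' cells bound sz ok.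
have [sorted_key key_eq] : (forall j, sorted ltn (keycol P j)) /\
    forall j, seqpred (keycol P j) =1 keypred N (colpred P) j.
  by split=> j; case: (keycolP _ hP N j) => // i v /colpredP[k cell <-]; apply: entry_N.
have [sorted_key' key_eq'] : (forall j, sorted ltn (keycol P' j)) /\
    forall j, seqpred (keycol P' j) =1 keypred N (colpred P') j.
  by split=> j; case: (keycolP _ hP' N j) => // i v /colpredP[k cell <-]; apply: bound.
have eq_key j : keypred N (colpred P') j =1 keypred N (colpred P) j ->
    keycol P' j = keycol P j.
  (* Key columns are strictly sorted lists, hence determined by their sets of entries. *)
  move=> e; apply: (irr_sorted_eq ltn_trans ltnn) => // v.
  by rewrite -!/(seqpred _ v) key_eq' key_eq e.
split=> [al|al]; move: ok; rewrite /settled /expected_keys al.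
  move=> eK; have size_eq : size P' = size P by apply: sz; rewrite al.
  rewrite /leftkey size_eq; apply/eq_in_map => i _.
  have -> : size (trow P' i) = size (trow P i).
    have cell_eq j : is_cell P' i j = is_cell P i j by rewrite cells al andbT.
    have := cell_eq (size (trow P i)); have := cell_eq (size (trow P' i)).
    rewrite /is_cell !ltnn; lia.
  by apply/eq_in_map => j _; rewrite eq_key.
case=> off [mn [k1 k2 k3 k4]].
split=> [j neq|]; first by rewrite !col_leftkey // eq_key //; apply: off.
exists mn; rewrite !col_leftkey // -!/(seqpred _ _) !key_eq; split=> //.
- move=> y; rewrite -!/(seqpred _ _) !key_eq => Ky nKy.
  by rewrite leqNgt; apply: contra nKy => lt_y; apply: k3.
by move=> y; rewrite inE -!/(seqpred _ _) key_eq' key_eq k4.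
Qed.
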